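(* The problem Hamiltonian Cycle has extension complexity $2^{O(k\log k)}\cdot n^{O(1)}$ on $n$-vertex graphs of treewidth at most $k$. Under ETH, this problem has no extended formulation with $2^{o(k)}n^{O(1)}$ inequalities.
   Context: Hamiltonian Cycle is the edge subset problem consisting of all pairs $(G,X)$ where $G$ is a graph and $X$ is the set of edges of some Hamiltonian cycle of $G$. For a graph $G$, the solution polytope $P_{\Pi}(G)$ is the convex hull of the 0/1 indicator vectors (indexed by $E_G$) of all solutions of $\Pi$ in $G$. A problem $\Pi$ has extension complexity $f(k,n)$ on $n$-vertex graphs of treewidth at most $k$ if for each such graph $G$, $P_{\Pi}(G)$ has extension complexity at most $f(k,n)$. $\Pi$ has no extended formulation with $g(k,n)$ inequalities if no polytope $P'$ that is an extended formulation of $P_{\Pi}(G)$ can be defined with $g(k,n)$ inequalities or fewer. *)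

(* Defs.v *)
From HB Require Import structures.
From mathcomp Require Import all_boot all_order all_algebra.
From mathcomp Require Import all_classical all_reals all_analysis.

Set Implicit Arguments.
Unset Strict Implicit.
Unset Printing Implicit Defensive.

Import Order.TTheory GRing.Theory Num.Theory.
Import numFieldNormedType.Exports.

Local Open Scope classical_set_scope.
Local Open Scope ring_scope.

Record sgraph : Type := SGraph {
  vertex :> finType;
  adj : rel vertex;
  adj_sym : symmetric adj;
  adj_irrefl : irreflexive adj
}.

Definition edges (G : sgraph) : {set {set G}} :=
  [set e : {set G} | [exists x, exists y, adj x y && (e == [set x; y]%SET)]]%SET.

(* A [ucycle] of size 2 merely traverses one edge back and forth. *)
Definition acyclic (G : sgraph) : Prop :=
  forall c : seq G, ucycle (@adj G) c -> (size c < 3)%N.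

Definition connected_graph (G : sgraph) : Prop :=
  forall x y : G, connect (@adj G) x y.

Definition is_tree (G : sgraph) : Prop :=
  [/\ (0 < #|G|)%N, connected_graph G & acyclic G].

Record is_tree_decomposition (G T : sgraph) (bag : T -> {set G}) : Prop := {
  td_tree : is_tree T;
  td_vertex : forall v : G, exists t, v \in bag t;
  td_edge : forall u v : G, adj u v ->
    exists t, (u \in bag t) && (v \in bag t);
  td_connected : forall (v : G) (s t : T), v \in bag s -> v \in bag t ->
    connect [rel a b | [&& adj a b, v \in bag a & v \in bag b]] s t
}.

Definition treewidth_at_most (G : sgraph) (k : nat) : Prop :=
  exists (T : sgraph) (bag : T -> {set G}),
    is_tree_decomposition bag /\ forall t, (#|bag t| <= k.+1)%N.

Definition edge_subset_problem : Type := forall G : sgraph, {set {set G}} -> Prop.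

Definition cycle_edges (G : sgraph) (c : seq G) : {set {set G}} :=
  [set [set x; next c x]%SET | x in c]%SET.

Definition hamiltonian_cycle_of (G : sgraph) (c : seq G) : Prop :=
  [/\ ucycle (@adj G) c, (3 <= size c)%N & forall x : G, x \in c].

Definition HamiltonianCycle : edge_subset_problem := fun G X =>
  exists2 c : seq G, hamiltonian_cycle_of c & X = cycle_edges c.

Section Polytopes.
Variable R : realType.

Definition conv_hull d (S : set 'cV[R]_d) : set 'cV[R]_d :=
  [set x | exists (m : nat) (v : 'I_m -> 'cV[R]_d) (a : 'I_m -> R),
     [/\ forall i, S (v i), forall i, 0 <= a i,
         \sum_i a i = 1 & x = \sum_i a i *: v i]].

(* The coordinates of R^{E_G} are numbered by the enumeration of [edges G]. *)
Definition indicator (G : sgraph) (X : {set {set G}}) : 'cV[R]_#|edges G| :=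
  \col_i (enum_val i \in X)%:R.

Definition solution_polytope (P : edge_subset_problem) (G : sgraph) :
    set 'cV[R]_#|edges G| :=
  conv_hull [set indicator X | X in P G].
Arguments solution_polytope P G : clear implicits.

Definition bounded_vectors d (Q : set 'cV[R]_d) : Prop :=
  exists M : R, forall z, Q z -> forall i, `|z i 0| <= M.

(* [Q] is a polytope described by [m] inequalities; linear equations are not
   counted, in accordance with size = number of facets. *)
Definition polytope_with_inequalities d (Q : set 'cV[R]_d) (m : nat) : Prop :=
  bounded_vectors Q /\
  exists (p : nat) (A : 'M[R]_(m, d)) (b : 'cV[R]_m)
         (C : 'M[R]_(p, d)) (c : 'cV[R]_p),
    Q = [set z | (forall i, (A *m z) i 0 <= b i 0) /\ C *m z = c].

(* The projection of R^(d + r) onto the first d coordinates is [usubmx]. *)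
Definition extended_formulation d r
    (P : set 'cV[R]_d) (Q : set 'cV[R]_(d + r)) : Prop :=
  P = [set usubmx z | z in Q].

Definition extension_complexity_at_most d (P : set 'cV[R]_d) (s : R) : Prop :=
  exists (r : nat) (Q : set 'cV[R]_(d + r)) (m : nat),
    [/\ polytope_with_inequalities Q m, extended_formulation P Q & m%:R <= s].

Definition has_extension_complexity
    (P : edge_subset_problem) (f : nat -> nat -> R) : Prop :=
  forall (k n : nat) (G : sgraph), #|G| = n -> treewidth_at_most G k ->
    extension_complexity_at_most (solution_polytope P G) (f k n).

Definition has_no_extended_formulation
    (P : edge_subset_problem) (g : nat -> nat -> R) : Prop :=
  exists (k n : nat) (G : sgraph),
    [/\ #|G| = n, treewidth_at_most G k &
      ~ extension_complexity_at_most (solution_polytope P G) (g k n)].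

End Polytopes.

(* Deterministic Turing machines with one two-way infinite tape. The blank is
   [None], the input symbols are [Some (inl b)], and [tm_aux] provides further
   work symbols. The transition function returns the new state, the written
   symbol and the head move ([None] = stay, [Some true] = right,
   [Some false] = left). *)
Record turing_machine : Type := TuringMachine {
  tm_state : finType;
  tm_aux : finType;
  tm_start : tm_state;
  tm_output : tm_state -> option bool;
  tm_trans : tm_state -> option (bool + tm_aux) ->
             tm_state * option (bool + tm_aux) * option bool
}.

Section TuringMachineRuns.
Variable M : turing_machine.

Definition tm_symbol : Type := option (bool + tm_aux M)%type.

(* State, tape to the left of the head (nearest cell first), and tape from the
   head on; all cells not listed are blank. *)
Definition tm_config : Type := (tm_state M * seq tm_symbol * seq tm_symbol)%type.

Definition tm_init (w : seq bool) : tm_config :=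
  (tm_start M, [::], [seq Some (inl b) | b <- w]).

Definition tm_step (c : tm_config) : tm_config :=
  let: (q, l, r) := c in
  if tm_output q is Some _ then c else
  let: (q', s, mv) := tm_trans q (head None r) in
  let r' := s :: behead r in
  match mv with
  | None => (q', l, r')
  | Some true => (q', s :: l, behead r')
  | Some false => (q', behead l, head None l :: r')
  end.

Definition tm_answers (w : seq bool) (a : bool) (t : nat) : Prop :=
  tm_output (iter t tm_step (tm_init w)).1.1 = Some a.

End TuringMachineRuns.

(* A clause has three literals, not necessarily distinct; the literal [(x, b)]
   is satisfied when [x] is assigned [b]. *)
Definition cnf3 (n : nat) : Type := seq (3.-tuple ('I_n * bool)).

Definition satisfiable n (phi : cnf3 n) : bool :=
  [exists s : {ffun 'I_n -> bool},
    all (fun cl : 3.-tuple ('I_n * bool) => has (fun l => s l.1 == l.2) cl) phi].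

Definition encode_literal n (l : 'I_n * bool) : seq bool :=
  nseq l.1 true ++ [:: false; l.2].

Definition encode_cnf3 n (phi : cnf3 n) : seq bool :=
  nseq n true ++ false :: flatten [seq flatten (map (@encode_literal n) cl)
                                   | cl : 3.-tuple ('I_n * bool) <- phi].

Definition solves_3SAT_in_time (M : turing_machine) (R : realType)
    (T : nat -> nat -> R) : Prop :=
  forall (n : nat) (phi : cnf3 n), exists t : nat,
    tm_answers M (encode_cnf3 phi) (satisfiable phi) t /\
    t%:R <= T n (size (encode_cnf3 phi)).

(* For some delta > 0, 3-SAT with n variables and input length L is not
   solvable in time O(2^(delta n) L^O(1)). *)
Definition ETH (R : realType) : Prop :=
  exists2 delta : R, 0 < delta &
    ~ exists (M : turing_machine) (C : R) (c : nat),
      solves_3SAT_in_time M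
        (fun n L => C * 2%:R `^ (delta * n%:R) * L%:R ^+ c).

(* Main.v *)
(** A set of edges is a Hamiltonian cycle iff it is spanning, connected and
    2-regular.

    Upper bound: dynamic programming along a tree decomposition only has to
    remember, on a boundary of at most w = k + 2 vertices, the degrees (capped at
    3) and the connectivity relation, hence at most (4 w) ^ w states.  Two
    distributions of partial solutions can be glued along any coupling of their
    state distributions, so that joining two parts costs one nonnegative variable
    per pair of states, and everything else is a linear equation.

    Lower bound: there is a graph with O(n^2) vertices and treewidth O(n) which
    has Hamiltonian cycles X_b (b a subset of [n]) and valid inequalities
    l_a >= 0 such that l_a (X_b) = 1 - |a /\ b| as soon as |a /\ b| <= 1.  A face
    of a polytope is determined by the inequalities that are tight on it, so an
    extended formulation with m inequalities yields m rectangles covering exactly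
    the pairs with l_a (X_b) > 0.  A rectangle without pairs |a /\ b| = 1 contains
    at most 2^n of the 3^n disjoint pairs (Kaibel and Weltge), whence
    m + 1 >= (3/2)^n. *)

Require Import Defs.
From HB Require Import structures.
From mathcomp Require Import all_boot all_order all_algebra.
From mathcomp Require Import all_classical all_reals all_analysis.
From mathcomp Require Import fintype finset zify ring lra.

Set Implicit Arguments.
Unset Strict Implicit.
Unset Printing Implicit Defensive.

Import Order.TTheory GRing.Theory Num.Theory.
Import numFieldNormedType.Exports.

(** * Hamiltonian cycles as connected 2-regular edge sets *)

Section EdgeSets.
Variable V : finType.
Implicit Types (X Y : {set {set V}}) (u v w : V).

(** Degrees are local conditions; connectivity is the global one. For the upper bound a vertex [r]
    is therefore added to every bag (whence k + 2) and never leaves the boundary, while every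
    interior vertex is required to reach the boundary; at the end this says that everything reaches
    [r]. Gluing along a coupling loses nothing because each edge lies on one side only: the
    indicator of a union is the sum of two indicators, so its expectation does not depend on how the
    two sides are correlated. For the lower bound the obstacle is that all n^2 pairs of elements
    must interact although the treewidth may only be linear in n. The graph is therefore laid out
    like a grid, with the crossing of rows i and j near the antidiagonal i + j. It is cubic with a
    perfect matching of forced edges; the remaining edges form even cycles, each of which is used in
    one of two alternating ways. An element of b is such a binary choice, and the connectivity of a
    Hamiltonian cycle creates the interaction: two absent rows isolate the ring at their crossing
    unless a toggle opens it. *)

Definition xadj X : rel V := fun u v => [set u; v] \in X.
Definition nbrs X v : {set V} := [set w | xadj X v w].

Lemma xadj_sym X : symmetric (xadj X).
Proof. by move=> u v; rewrite /xadj setUC. Qed.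

Lemma connect_xadjC X u v : connect (xadj X) u v = connect (xadj X) v u.
Proof. exact/sym_connect_sym/xadj_sym. Qed.

Lemma set2_eq u v x y : [set u; v] = [set x; y] ->
  (u = x /\ v = y) \/ (u = y /\ v = x).
Proof.
move=> E.
have: u \in [set x; y] by rewrite -E set21.
have: v \in [set x; y] by rewrite -E set22.
have: x \in [set u; v] by rewrite E set21.
have: y \in [set u; v] by rewrite E set22.
rewrite !inE.
do 4![case/orP=> /eqP ?]; subst; auto.
Qed.

End EdgeSets.

Lemma in_edges (G : sgraph) (u v : G) : ([set u; v] \in edges G) = adj u v.
Proof.
rewrite inE; apply/existsP/idP => [[x /existsP[y /andP[xy /eqP]]]|uv].
  by case/set2_eq=> [][-> ->] //; rewrite adj_sym.
by exists u; apply/existsP; exists v; rewrite uv eqxx.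
Qed.

Lemma edgesP (G : sgraph) (e : {set G}) :
  reflect (exists u v : G, adj u v /\ e = [set u; v]) (e \in edges G).
Proof.
rewrite inE; apply: (iffP existsP) => [[u /existsP[v /andP[uv /eqP ->]]]|[u [v [uv ->]]]].
  by exists u, v.
by exists u; apply/existsP; exists v; rewrite uv eqxx.
Qed.

Lemma next_next_neq (T : eqType) (c : seq T) x :
  uniq c -> (3 <= size c)%N -> x \in c -> next c (next c x) != x.
Proof.
move=> uc sc /rot_to[i s E].
rewrite -!(next_rot i uc) E.
have : uniq (x :: s) by rewrite -E rot_uniq.
have : (3 <= size (x :: s))%N by rewrite -E size_rot.
case: s {E} => [|y [|z s]] //= _; rewrite !inE eqxx => /andP[].
by rewrite !negb_or => /and3P[xy xz _] _; rewrite (eq_sym y x) (negPf xy) eqxx eq_sym.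
Qed.

(** For the converse take a longest path: all neighbours of its last vertex lie on it, and
    2-regularity leaves only the first vertex as the second neighbour. The cycle so closed is stable
    under adjacency, hence spanning by connectivity. *)
Lemma hamiltonianP (G : sgraph) (X : {set {set G}}) : HamiltonianCycle X <->
  [/\ X \subset edges G, forall v, #|nbrs X v| = 2,
      forall u v, connect (xadj X) u v & (0 < #|G|)%N].
Proof.
split.
  case=> c [/andP[cy uc] sc inc] ->.
  have adjN x : adj x (next c x) by apply: next_cycle cy _.
  have xadjE u v : xadj (cycle_edges c) u v = (v == next c u) || (u == next c v).
    rewrite /xadj; apply/imsetP/idP => [[x xc /set2_eq[[-> ->]|[-> ->]]]|].
    - by rewrite eqxx.
    - by rewrite eqxx orbT.
    by case/orP => /eqP ->; [exists u|exists v; rewrite // setUC].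
  split.
  - by apply/subsetP => e /imsetP[x _ ->]; rewrite in_edges.
  - move=> v; have -> : nbrs (cycle_edges c) v = [set next c v; prev c v].
      apply/setP => w; rewrite !inE xadjE; congr (_ || _).
      apply/eqP/eqP => ->; by rewrite (prev_next uc, next_prev uc).
    rewrite cards2; case: eqP => // E.
    by have := next_next_neq uc sc (inc v); rewrite E next_prev // eqxx.
  - move=> u v.
    have fc : fcycle (next c) c by exact: cycle_next.
    have : fconnect (next c) u v by rewrite (fconnect_cycle fc (inc u)).
    by apply: connect_sub => x y /eqP <-; rewrite connect1 // xadjE eqxx.
  - by case: c sc {cy uc inc adjN xadjE} => // x c _; apply/card_gt0P; exists x.
case=> sX dX cX /card_gt0P[v0 _].
have irr x : ~~ xadj X x x.
  by apply/negP => /(subsetP sX); rewrite in_edges adj_irrefl.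
pose good n := [exists t : n.-tuple G, uniq t && (if tval t is x :: p then path (xadj X) x p else false)].
have g1 : good 1%N by apply/existsP; exists [tuple v0].
have gb n : good n -> (n <= #|G|)%N.
  by case/existsP => t /andP[ut _]; rewrite -(size_tuple t) -(card_uniqP ut) max_card.
case: (ex_maxnP (ex_intro (fun n => good n) _ g1) gb) => n /existsP[[s sz] /andP[ut pth]] mx.
case: s sz ut pth => // x p sz ut pth; simpl in pth; change (is_true (uniq (x :: p))) in ut.
have mxs q y : uniq (y :: q) -> path (xadj X) y q -> (size q <= size p)%N.
  move=> uq pq; rewrite -ltnS -[(size p).+1]/(size (x :: p)) (eqP sz); apply: mx.
  by apply/existsP; exists (in_tuple (y :: q)); rewrite uq.
have out_last y : xadj X (last x p) y -> y \in x :: p.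
  move=> ly; apply/negPn/negP => yN.
  have := mxs (rcons p y) x; rewrite -rcons_cons rcons_uniq ut yN rcons_path pth ly size_rcons.
  by move=> /(_ isT isT); rewrite ltnn.
have nb3 v a b c : xadj X v a -> xadj X v b -> xadj X v c -> a != b -> a != c -> b = c.
  move=> va vb vc ab ac; apply/eqP/negPn/negP => bc.
  have : ([set a; b; c] \subset nbrs X v).
    by apply/subsetP => z; rewrite !inE => /orP[/orP[]|] /eqP ->.
  move/subset_leq_card; rewrite dX setUC cardsU1 cards2 !inE ab.
  by rewrite (eq_sym c a) (negPf ac) (eq_sym c b) (negPf bc).
have [p' [y Ep]] : exists p' y, p = rcons p' y.
  case/lastP: p {sz mx mxs ut pth} out_last => [|p' y] out_last; last by exists p', y.
  have /card_gt0P[a] : (0 < #|nbrs X x|)%N by rewrite dX.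
  by rewrite inE => xa; have := out_last a xa; rewrite inE => /eqP E; move: xa; rewrite E (negPf (irr x)).
subst p; rewrite last_rcons in out_last; move: pth; rewrite rcons_path => /andP[pth py].
have yy0 : xadj X y (last x p') by rewrite xadj_sym.
have [z yz zy0] : exists2 z, xadj X y z & z != last x p'.
  have /card_gt0P[z] : (0 < #|nbrs X y :\ last x p'|)%N.
    by have := cardsD1 (last x p') (nbrs X y); rewrite dX inE yy0; case: #|_|.
  by rewrite !inE => /andP[zy yz]; exists z.
(* At an inner vertex [z] of the path, [y] would be a third neighbour. *)
have zx : z = x.
  have := out_last _ yz; rewrite inE mem_rcons inE => /or3P[/eqP //|/eqP E|zp].
    by move: yz; rewrite E (negPf (irr y)).
  case/splitPr: zp pth ut zy0 {mxs out_last py yy0 sz} => q1 [|z2 q3] pth ut zy0.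
    by rewrite last_cat /= eqxx in zy0.
  move: pth; rewrite cat_path /= => /and4P[_ az zz2 _].
  have := ut; rewrite -rcons_cons -cats1 -cat_cons -catA cat_uniq => /and3P[uq1 dj].
  rewrite /= => /andP[_]; rewrite cats1 mem_rcons inE negb_or => /andP[/andP[z2y _] _].
  have aN : forall t, t \in [:: z, z2 & q3] ++ [:: y] -> last x q1 != t.
    move=> t tin; apply/eqP => E; move/hasPn: dj => /(_ t tin) /=.
    by rewrite -E mem_last.
  have : z2 = y; last by move/eqP; rewrite (negPf z2y).
  apply: (nb3 z (last x q1)) => //; rewrite ?(xadj_sym X z) //.
    by apply: aN; rewrite !inE eqxx orbT.
  by apply: aN; rewrite mem_cat !inE eqxx !orbT.
subst z; set c := x :: rcons p' y.
have sc : (3 <= size c)%N by rewrite /= size_rcons; case: (p') zy0 => //=; rewrite eqxx.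
have cyc : cycle (xadj X) c by rewrite /= !rcons_path last_rcons pth py yz.
have nbc v w : v \in c -> xadj X v w -> w = next c v \/ w = prev c v.
  move=> vc vw; case: (eqVneq w (next c v)) => [|wn]; [by left|right].
  apply/esym/(nb3 v (next c v)) => //; first exact: next_cycle cyc vc.
  - by rewrite xadj_sym; apply: prev_cycle cyc vc.
  - apply/eqP => E; have := next_next_neq ut sc vc.
    by rewrite E next_prev // eqxx.
  - by rewrite eq_sym.
have inc v : v \in c.
  have cl : closed_mem (xadj X) (mem c).
    apply: intro_closed; first exact/sym_connect_sym/xadj_sym.
    by move=> a b ab ac; case: (nbc _ _ ac ab) => ->; rewrite ?mem_next ?mem_prev.
  by have := closed_connect cl (cX x v); rewrite !inE eqxx => <-.
exists c.
  split=> //; apply/andP; split=> //; apply: sub_cycle cyc => a b ab.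
  by rewrite -in_edges (subsetP sX).
apply/setP => e; apply/idP/imsetP => [eX|[a ac ->]]; last exact: next_cycle cyc ac.
have /edgesP[u [v [uv E]]] := subsetP sX _ eX.
subst e; case: (nbc u v (inc u) eX) => ->; first by exists u.
by exists (prev c u); rewrite ?inc // next_prev // setUC.
Qed.

(** * Tree decompositions as lists of bags *)

Fixpoint running_intersection (V : finType) (bs : seq {set V}) : Prop :=
  if bs is b :: s then
    (s = [::] \/ exists2 b', b' \in s &
       forall v b'', v \in b -> b'' \in s -> v \in b'' -> v \in b') /\ running_intersection s
  else True.

(** Take the first vertex of a longest path in [U]: each of its neighbours in [U] lies on the path
    by maximality, and one beyond the second vertex would close a cycle of length at least 3. *)
Lemma acyclic_leaf (T : sgraph) (U : {set T}) (t0 : T) :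
  acyclic T -> t0 \in U ->
  exists2 l, l \in U & forall x y, x \in U -> y \in U -> adj l x -> adj l y -> x = y.
Proof.
move=> acT t0U.
pose good n := [exists t : n.-tuple T,
  [&& uniq t, all (mem U) t & if tval t is x :: p then path (@adj T) x p else false]].
have g1 : good 1 by apply/existsP; exists [tuple t0]; rewrite /= t0U.
have gb n : good n -> n <= #|T|.
  by case/existsP => t /andP[ut _]; rewrite -(size_tuple t) -(card_uniqP ut) max_card.
case: (ex_maxnP (ex_intro (fun n => good n) _ g1) gb) => n /existsP[[s sz] /and3P[ut sU pth]] mx.
case: s sz ut sU pth => // x p sz ut sU pth; simpl in pth.
change (is_true (uniq (x :: p))) in ut; change (is_true (all (mem U) (x :: p))) in sU.
have inp a : a \in U -> adj x a -> a \in p.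
  move=> aU xa; apply/negPn/negP => aN.
  have : size (x :: p) < size (x :: p); last by rewrite ltnn.
  rewrite [X in _ <= X](eqP sz); apply: (mx (size [:: a, x & p])); apply/existsP.
  exists (in_tuple [:: a, x & p]); apply/and3P; split.
  - rewrite /= inE negb_or aN -[_ && uniq p]/(uniq (x :: p)) ut !andbT.
    by apply/eqP => E; move: xa; rewrite E adj_irrefl.
  - by rewrite /= aU.
  - by rewrite /= adj_sym xa.
have noc y q a : p = y :: q -> a \in q -> adj x a -> False.
  move=> Ep aq xa; case/splitPr: aq Ep => q1 q2 Ep.
  have := acT (x :: y :: rcons q1 a).
  rewrite /ucycle => /(_ _) H; suff: size [:: x, y & rcons q1 a] < 3 by rewrite /= size_rcons.
  apply: H; apply/andP; split.
    move: pth; rewrite Ep /= -cat_rcons cat_path => /andP[-> /andP[p1 _]].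
    by rewrite rcons_path p1 last_rcons adj_sym.
  move: ut; rewrite Ep -cat_rcons -!cat_cons cat_uniq => /and3P[] //.
exists x; first by case/andP: sU.
move=> a b aU bU xa xb.
have := inp _ aU xa; have := inp _ bU xb.
case Ep: p => [|y q] //; rewrite !inE => /orP[/eqP ->|bq]; last by case: (noc _ _ _ Ep bq xb).
by case/orP => [/eqP //|aq]; case: (noc _ _ _ Ep aq xa).
Qed.

(** Leaves are stripped one by one and listed first; the later bag assigned to a leaf is that of its
    only remaining neighbour. The induction runs over node sets [U] with connectivity inside [U], a
    property that survives because a simple path between other nodes cannot pass through a leaf. *)
Lemma tree_rip (V : finType) (T : sgraph) (bag : T -> {set V}) :
  acyclic T ->
  (forall (v : V) (s t : T), v \in bag s -> v \in bag t ->
    connect [rel a b | [&& adj a b, v \in bag a & v \in bag b]] s t) ->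
  exists2 l : seq T, (forall t, t \in l) & running_intersection (map bag l).
Proof.
move=> acT cT.
suff H n (U : {set T}) : #|U| = n ->
  (forall (v : V) (s t : T), s \in U -> t \in U -> v \in bag s -> v \in bag t ->
    connect [rel a b | [&& adj a b, a \in U, b \in U, v \in bag a & v \in bag b]] s t) ->
  exists2 l : seq T, l =i U & running_intersection (map bag l).
  have [|l lT rl] := H _ [set: T] erefl.
    move=> v s t _ _ vs vt; apply: connect_sub (cT v s t vs vt) => a b /= /and3P[ab va vb].
    by apply: connect1; rewrite /= !inE ab va vb.
  by exists l => // t; rewrite lT inE.
elim: n U => [|n IH] U cU HU.
  by exists [::] => // t; rewrite (cards0_eq cU) inE.
have /card_gt0P[t0 t0U] : 0 < #|U| by rewrite cU.
have [l lU lleaf] := acyclic_leaf acT t0U.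
have [||s sU rs] := IH (U :\ l).
- by have := cardsD1 l U; rewrite lU cU => -[].
- move=> v s t; rewrite !inE => /andP[sl sU] /andP[tl tU] vs vt.
  have /connectP[p0 pp0 Ep0] := HU v s t sU tU vs vt.
  case/shortenP: pp0 Ep0 => p pth ut _ Et.
  have lp : l \notin p.
    apply/negP => lp; case/splitPr: lp pth ut Et => q1 [|z q3] pth ut Et.
      by move: tl; rewrite Et last_cat /= eqxx.
    move: pth; rewrite cat_path /= => /and4P[_ /and5P[al aU _ _ _] /and5P[lz _ zU _ _] _].
    have := lleaf _ _ aU zU; rewrite adj_sym => /(_ al lz) E.
    move: ut; rewrite -cat_cons cat_uniq => /and3P[_ /hasPn/(_ z) H _].
    by have := H; rewrite !inE eqxx orbT => /(_ isT); rewrite -E -in_cons mem_last.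
  apply/connectP; exists p => //.
  have al : all (fun x => x != l) (s :: p).
    by rewrite /= sl; apply/allP => x xp; apply: contraNneq lp => <-.
  apply: (sub_in_path (P := fun x => x != l)) al pth => a b /= al bl.
  by case/and5P => ab aU bU va vb; rewrite !inE (negPf al) (negPf bl) ab aU bU va vb.
exists (l :: s) => [t|/=]; first by rewrite inE sU !inE; case: eqVneq => [->|].
split=> //; case: (s) sU => [|s0 s'] sU; [by left|right].
case: (pickP [pred p in U | adj l p]) => [p /andP[pU lp]|nop].
  exists (bag p).
    apply: map_f; rewrite sU !inE pU andbT; apply/eqP => E.
    by move: lp; rewrite E adj_irrefl.
  move=> v b'' vl /mapP[t]; rewrite sU !inE => /andP[tl tU] -> vt.
  have /connectP[[|q ps] /= pth Et] := HU v l t lU tU vl vt.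
    by rewrite Et eqxx in tl.
  case/andP: pth => /and5P[lq _ qU _ vq] _.
  by rewrite -(lleaf _ _ qU pU lq lp).
(* A leaf without neighbours in [U] shares no vertex with the other bags, so any of them will do. *)
exists (bag s0); first by rewrite /= mem_head.
move=> v b'' vl /mapP[t]; rewrite sU !inE => /andP[tl tU] -> vt.
have /connectP[[|q ps] /= pth Et] := HU v l t lU tU vl vt.
  by rewrite Et eqxx in tl.
by case/andP: pth => /and5P[lq _ qU _ vq] _; have := nop q; rewrite /= qU lq.
Qed.

(** * Linear descriptions of finite families of sets *)

Section Rep.
Variable R : realType.
Local Open Scope ring_scope.

Lemma pushsum (J T : finType) (f : J -> T) (y : J -> R) (P : pred T) :
  \sum_(X | P X) \sum_(j | f j == X) y j = \sum_(j | P (f j)) y j.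
Proof.
rewrite (partition_big f P) //=; apply: eq_bigr => X PX; apply: eq_bigl => j.
by case: eqP => [->|]; rewrite ?PX ?andbF.
Qed.

(** Conditional independence: draw a pair of states from [mu], then each side on its own given its
    state. Where a state has weight 0, [mu] and the weights over that state vanish as well, so the
    convention for division by 0 is harmless. *)
Lemma coupling (T1 T2 S1 S2 : finType) (st1 : T1 -> S1) (st2 : T2 -> S2)
  (w1 : T1 -> R) (w2 : T2 -> R) (mu : S1 * S2 -> R) :
  (forall X, 0 <= w1 X) -> (forall X, 0 <= w2 X) -> (forall t, 0 <= mu t) ->
  (forall s, \sum_(t | t.1 == s) mu t = \sum_(X | st1 X == s) w1 X) ->
  (forall s, \sum_(t | t.2 == s) mu t = \sum_(X | st2 X == s) w2 X) ->
  exists q : T1 * T2 -> R, [/\ forall p, 0 <= q p,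
    forall X, \sum_(p | p.1 == X) q p = w1 X,
    forall X, \sum_(p | p.2 == X) q p = w2 X &
    forall P : pred (S1 * S2), \sum_(p | P (st1 p.1, st2 p.2)) q p = \sum_(t | P t) mu t].
Proof.
move=> w1P w2P muP m1 m2.
pose l1 s := \sum_(X | st1 X == s) w1 X; pose l2 s := \sum_(X | st2 X == s) w2 X.
have l1P s : 0 <= l1 s by apply: sumr_ge0.
have l2P s : 0 <= l2 s by apply: sumr_ge0.
have mu1 t : l1 t.1 = 0 -> mu t = 0.
  rewrite /l1 -m1 => /eqP; rewrite psumr_eq0 // => /allP/(_ t).
  by rewrite mem_index_enum eqxx => /(_ isT)/eqP.
have mu2 t : l2 t.2 = 0 -> mu t = 0.
  rewrite /l2 -m2 => /eqP; rewrite psumr_eq0 // => /allP/(_ t).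
  by rewrite mem_index_enum eqxx => /(_ isT)/eqP.
have w10 X : l1 (st1 X) = 0 -> w1 X = 0.
  move=> /eqP; rewrite psumr_eq0 // => /allP/(_ X).
  by rewrite mem_index_enum eqxx => /(_ isT)/eqP.
have w20 X : l2 (st2 X) = 0 -> w2 X = 0.
  move=> /eqP; rewrite psumr_eq0 // => /allP/(_ X).
  by rewrite mem_index_enum eqxx => /(_ isT)/eqP.
pose q p := w1 p.1 * w2 p.2 * mu (st1 p.1, st2 p.2) / (l1 (st1 p.1) * l2 (st2 p.2)).
exists q; split.
- by move=> p; rewrite /q divr_ge0 ?mulr_ge0.
- move=> X1.
  rewrite (partition_big (fun p : T1 * T2 => (st1 p.1, st2 p.2)) (fun t => t.1 == st1 X1)) /=; last first.
    by move=> p /eqP ->.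
  transitivity (\sum_(t | t.1 == st1 X1) w1 X1 / l1 (st1 X1) * mu t).
    apply: eq_bigr => -[s1 s2] /= /eqP ->.
    transitivity (\sum_(X2 | st2 X2 == s2) q (X1, X2)).
      rewrite (reindex_onto (fun X2 => (X1, X2)) (fun p => p.2)) /=; last first.
        by case=> a b /= /andP[/eqP -> _].
      apply: eq_bigl => X2; rewrite !eqxx /= andbT.
      by apply/eqP/eqP => [[//]|->].
    have -> : \sum_(X2 | st2 X2 == s2) q (X1, X2) =
        w1 X1 * l2 s2 * mu (st1 X1, s2) / (l1 (st1 X1) * l2 s2).
      rewrite /l2 mulr_sumr !mulr_suml; apply: eq_bigr => X2 /eqP E; rewrite /q /= E.
      by rewrite /l2 mulr_suml.
    have [z|nz] := eqVneq (l2 s2) 0.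
      by rewrite (mu2 (st1 X1, s2)) // !mulr0 mul0r.
    have [z|nz1] := eqVneq (l1 (st1 X1)) 0; first by rewrite w10 // !mul0r.
    by field; rewrite nz nz1.
  rewrite -mulr_sumr m1 -/(l1 _).
  have [z|nz1] := eqVneq (l1 (st1 X1)) 0; first by rewrite w10 // !mul0r.
  by rewrite divfK.
- move=> X2.
  rewrite (partition_big (fun p : T1 * T2 => (st1 p.1, st2 p.2)) (fun t => t.2 == st2 X2)) /=; last first.
    by move=> p /eqP ->.
  transitivity (\sum_(t | t.2 == st2 X2) w2 X2 / l2 (st2 X2) * mu t).
    apply: eq_bigr => -[s1 s2] /= /eqP ->.
    transitivity (\sum_(X1 | st1 X1 == s1) q (X1, X2)).
      rewrite (reindex_onto (fun X1 => (X1, X2)) (fun p => p.1)) /=; last first.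
        by case=> a b /= /andP[/eqP -> _].
      apply: eq_bigl => X1; rewrite !eqxx /= andbT.
      by apply/eqP/eqP => [[//]|->].
    have -> : \sum_(X1 | st1 X1 == s1) q (X1, X2) =
        l1 s1 * w2 X2 * mu (s1, st2 X2) / (l1 s1 * l2 (st2 X2)).
      rewrite {1}/l1 !mulr_suml; apply: eq_bigr => X1 /eqP E; rewrite /q /= E.
      by rewrite /l1 mulr_suml.
    have [z|nz] := eqVneq (l1 s1) 0.
      by rewrite (mu1 (s1, st2 X2)) // !mulr0 mul0r.
    have [z|nz1] := eqVneq (l2 (st2 X2)) 0; first by rewrite w20 // !mul0r mulr0 !mul0r.
    by field; rewrite nz nz1.
  rewrite -mulr_sumr m2 -/(l2 _).
  have [z|nz1] := eqVneq (l2 (st2 X2)) 0; first by rewrite w20 // !mul0r.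
  by rewrite divfK.
- move=> P.
  rewrite (partition_big (fun p : T1 * T2 => (st1 p.1, st2 p.2)) P) //=.
  apply: eq_bigr => -[s1 s2] Ps.
  transitivity (\sum_(X1 | st1 X1 == s1) \sum_(X2 | st2 X2 == s2) q (X1, X2)).
    rewrite pair_big /=; apply: eq_big => [[a b]|[a b] _] //=.
    by apply/andP/andP => [[_ /eqP[-> ->]]|[/eqP -> /eqP ->]].
  have -> : \sum_(X1 | st1 X1 == s1) \sum_(X2 | st2 X2 == s2) q (X1, X2) =
      l1 s1 * l2 s2 * mu (s1, s2) / (l1 s1 * l2 s2).
    under eq_bigr => X1 /eqP E1 do under eq_bigr => X2 /eqP E2 do
      rewrite /q /= E1 E2.
    move: (l1 s1 * l2 s2)^-1 => d; rewrite /l1 /l2 !mulr_suml; apply: eq_bigr => X1 _.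
    by rewrite mulr_sumr !mulr_suml.
  have [z|nz] := eqVneq (l1 s1) 0; first by rewrite (mu1 (s1, s2)) // !mulr0 mul0r.
  have [z|nz2] := eqVneq (l2 s2) 0; first by rewrite (mu2 (s1, s2)) // !mulr0 mul0r.
  by field; rewrite nz nz2.
Qed.

Definition dot (J : finType) (c y : J -> R) : R := \sum_j c j * y j.

Lemma dot0 (J : finType) (y : J -> R) : dot (fun _ => 0) y = 0.
Proof. by rewrite /dot big1 // => j _; rewrite mul0r. Qed.

Lemma dot_ind (J : finType) (P : pred J) (y : J -> R) :
  dot (fun j => (P j)%:R) y = \sum_(j | P j) y j.
Proof.
rewrite /dot [RHS]big_mkcond /=; apply: eq_bigr => j _.
by case: (P j); rewrite ?mul1r ?mul0r.
Qed.

Definition case_sum3 (J1 J2 J3 : Type) (c1 : J1 -> R) (c2 : J2 -> R) (c3 : J3 -> R)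
    (j : J1 + J2 + J3) : R :=
  match j with inl (inl j) => c1 j | inl (inr j) => c2 j | inr j => c3 j end.

Lemma dot_case_sum3 (J1 J2 J3 : finType) (c1 : J1 -> R) (c2 : J2 -> R) (c3 : J3 -> R) y :
  dot (case_sum3 c1 c2 c3) y = dot c1 (fun j => y (inl (inl j))) +
    dot c2 (fun j => y (inl (inr j))) + dot c3 (fun j => y (inr j)).
Proof. by rewrite /dot !big_sumType. Qed.

Variable E : finType.

(* The points y of the cone {y >= 0, C y = 0} lie over the measures w on the
   solutions: [L y] lists the measures of the events "e in X" and [Lam y] those of
   the states.  The bound on y j keeps the fibre over probability measures bounded. *)
Definition represents (St : finType) (good : pred {set E}) (st : {set E} -> St) (m : nat) : Prop :=
  exists (J I : finType) (C : I -> J -> R) (L : E -> J -> R) (Lam : St -> J -> R),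
  [/\ (#|J| <= m)%N,
    (forall y : J -> R, (forall j, 0 <= y j) -> (forall i, dot (C i) y = 0) ->
      exists w : {set E} -> R,
       [/\ forall X, 0 <= w X, forall X, w X != 0 -> good X,
           forall s, dot (Lam s) y = \sum_(X | st X == s) w X,
           forall e, dot (L e) y = \sum_(X : {set E} | e \in X) w X &
           forall j, y j <= \sum_X w X]) &
    (forall X, good X -> exists y : J -> R,
       [/\ forall j, 0 <= y j, forall i, dot (C i) y = 0,
           forall s, dot (Lam s) y = (st X == s)%:R &
           forall e, dot (L e) y = (e \in X)%:R])].

Lemma rep_leaf (St : finType) (good : {set {set E}}) (st : {set E} -> St) :
  represents (mem good) st #|good|.
Proof.
pose ev (j : 'I_#|good|) : {set E} := enum_val j.
exists 'I_#|good|, void, (fun (i : void) _ => match i with end),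
  (fun e j => (e \in ev j)%:R), (fun s j => (st (ev j) == s)%:R).
split; first by rewrite card_ord.
  move=> y y0 _; exists (fun X => \sum_(j | ev j == X) y j); split.
  - by move=> X; apply: sumr_ge0.
  - move=> X; apply: contraNT => nX; rewrite big1 // => j /eqP E0.
    by have := enum_valP j; rewrite -/(ev j) E0 => gX; move: nX; rewrite /= gX.
  - by move=> s; rewrite pushsum dot_ind.
  - by move=> e; rewrite pushsum dot_ind.
  - move=> j; rewrite (pushsum _ _ predT) (bigD1 j) //= lerDl.
    exact: sumr_ge0.
move=> X gX; exists (fun j => (ev j == X)%:R); split => //.
- move=> s; rewrite dot_ind big_mkcond /= (bigD1 (enum_rank_in gX X)) //= big1.
    by rewrite /ev enum_rankK_in // eqxx addr0; case: ifP.
  move=> j /eqP nj; case: ifP => // _; case: eqP => // E0; case: nj.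
  by rewrite -[LHS](enum_valK_in gX) -/(ev j) E0.
- move=> e; rewrite dot_ind big_mkcond /= (bigD1 (enum_rank_in gX X)) //= big1.
    by rewrite /ev enum_rankK_in // eqxx addr0; case: ifP.
  move=> j /eqP nj; case: ifP => // _; case: eqP => // E0; case: nj.
  by rewrite -[LHS](enum_valK_in gX) -/(ev j) E0.
Qed.

(** Forbidding a state costs an equation and no variable: its total weight is the linear form
    [Lam s], and setting this to 0 kills, by nonnegativity, every solution in that state. Coarsening
    the states only adds up such forms. *)
Lemma rep_restrict (St St' : finType) (good good' : pred {set E}) (st : {set E} -> St)
    (st' : {set E} -> St') (ok : pred St) (h : St -> St') m :
  represents good st m ->
  (forall X, good' X = good X && ok (st X)) ->
  (forall X, good' X -> st' X = h (st X)) ->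
  represents good' st' m.
Proof.
move=> [J [I [C [L [Lam [cJ snd cpl]]]]]] Hg Hs.
exists J, (I + St)%type, (fun i => match i with inl i => C i
  | inr s => if ok s then fun _ => 0 else Lam s end), L,
  (fun s' j => \sum_(s | h s == s') Lam s j).
split=> //.
  move=> y y0 Cy; have [|w [w0 wg wL wE wB]] := snd y y0.
    by move=> i; exact: (Cy (inl i)).
  have wg' X : w X != 0 -> good' X.
    move=> wX; rewrite Hg wg //=; apply/negPn/negP => nok.
    have := Cy (inr (st X)); rewrite (negPf nok) wL => /eqP.
    rewrite psumr_eq0 // => /allP/(_ X); rewrite mem_index_enum eqxx => /(_ isT).
    by rewrite (negPf wX).
  exists w; split=> // s'.
  rewrite /dot; under eq_bigr => j _ do rewrite mulr_suml.
  rewrite exchange_big /=; under eq_bigr => s _ do rewrite -/(dot (Lam s) y) wL.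
  rewrite pushsum; rewrite big_mkcond [RHS]big_mkcond /=; apply: eq_bigr => X _.
  have [->|wX] := eqVneq (w X) 0; first by rewrite !if_same.
  by rewrite Hs // wg'.
move=> X gX; have := gX; rewrite Hg => /andP[gX0 okX].
have [y [y0 Cy Ly Ey]] := cpl X gX0; exists y; split=> //.
  case=> [i|s]; first exact: Cy.
  case: ifP => [_|nok]; first by rewrite dot0.
  by rewrite Ly; case: eqP => // E0; rewrite -E0 okX in nok.
move=> s'; rewrite /dot; under eq_bigr => j _ do rewrite mulr_suml.
rewrite exchange_big /=; under eq_bigr => s _ do rewrite -/(dot (Lam s) y) Ly.
rewrite Hs // big_mkcond (bigD1 (st X)) //= eqxx big1 ?addr0; first by case: eqP.
by move=> s; rewrite eq_sym => /negPf ->; rewrite if_same.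
Qed.

(** The new variables are the weights of pairs of states, and the new equations fix their two
    marginals; [coupling] turns them into a measure on pairs of solutions. The sets [A1] and [A2]
    serve to count only states that can occur, as the state types may be far larger. *)
Lemma rep_join (S1 S2 S3 : finType) (g1 g2 g3 : pred {set E})
    (st1 : {set E} -> S1) (st2 : {set E} -> S2) (st3 : {set E} -> S3)
    (g : S1 -> S2 -> S3) (A1 : {set S1}) (A2 : {set S2}) m1 m2 :
  represents g1 st1 m1 -> represents g2 st2 m2 ->
  (forall X, g1 X -> st1 X \in A1) -> (forall X, g2 X -> st2 X \in A2) ->
  (forall X1 X2, g1 X1 -> g2 X2 -> [/\ [disjoint X1 & X2], g3 (X1 :|: X2) &
     st3 (X1 :|: X2) = g (st1 X1) (st2 X2)]) ->
  (forall X, g3 X -> exists X1 X2, [/\ g1 X1, g2 X2 & X = X1 :|: X2]) ->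
  represents g3 st3 (m1 + m2 + #|A1| * #|A2|).
Proof.
move=> [J1 [I1 [C1 [L1 [M1 [cJ1 snd1 cpl1]]]]]] [J2 [I2 [C2 [L2 [M2 [cJ2 snd2 cpl2]]]]]].
move=> HA1 HA2 Hcomp Hdec.
pose K := 'I_#|setX A1 A2|.
pose ev (k : K) : S1 * S2 := enum_val k.
pose z J := (fun _ : J => 0 : R).
exists (J1 + J2 + K)%type, (I1 + I2 + (S1 + S2))%type,
  (fun i => match i with
     | inl (inl i) => case_sum3 (C1 i) (z J2) (z K)
     | inl (inr i) => case_sum3 (z J1) (C2 i) (z K)
     | inr (inl s) => case_sum3 (fun j => - M1 s j) (z J2) (fun k => ((ev k).1 == s)%:R)
     | inr (inr s) => case_sum3 (z J1) (fun j => - M2 s j) (fun k => ((ev k).2 == s)%:R)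
     end),
  (fun e => case_sum3 (L1 e) (L2 e) (z K)),
  (fun s => case_sum3 (z J1) (z J2) (fun k => (g (ev k).1 (ev k).2 == s)%:R)).
have dotN (J : finType) (c y : J -> R) : dot (fun j => - c j) y = - dot c y.
  by rewrite /dot -sumrN; apply: eq_bigr => j _; rewrite mulNr.
split.
- by rewrite !card_sum card_ord cardsX leq_add // leq_add.
- move=> y y0 Cy.
  set y1 := fun j => y (inl (inl j)); set y2 := fun j => y (inl (inr j)).
  set y3 := fun k => y (inr k).
  have [||w1 [w10 wg1 wM1 wE1 wB1]] := snd1 y1; first by move=> j; apply: y0.
    by move=> i; have := Cy (inl (inl i)); rewrite dot_case_sum3 !dot0 !addr0.
  have [||w2 [w20 wg2 wM2 wE2 wB2]] := snd2 y2; first by move=> j; apply: y0.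
    by move=> i; have := Cy (inl (inr i)); rewrite dot_case_sum3 !dot0 add0r addr0.
  have y30 k : 0 <= y3 k by apply: y0.
  have [|||q [q0 q1 q2 qP]] := @coupling _ _ _ _ st1 st2 w1 w2
      (fun t => \sum_(k | ev k == t) y3 k) w10 w20.
  + by move=> t; apply: sumr_ge0.
  + move=> s; rewrite (pushsum ev y3 (fun t => t.1 == s)) -wM1.
    have := Cy (inr (inl s)); rewrite dot_case_sum3 dot0 addr0 dotN dot_ind => /eqP.
    by rewrite addrC subr_eq0 => /eqP.
  + move=> s; rewrite (pushsum ev y3 (fun t => t.2 == s)) -wM2.
    have := Cy (inr (inr s)); rewrite dot_case_sum3 dot0 add0r dotN dot_ind => /eqP.
    by rewrite addrC subr_eq0 => /eqP.
  have qw1 p : q p != 0 -> w1 p.1 != 0.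
    apply: contraNneq => W; have := q1 p.1; rewrite W => /eqP.
    by rewrite psumr_eq0 // => /allP/(_ p); rewrite mem_index_enum eqxx => /(_ isT).
  have qw2 p : q p != 0 -> w2 p.2 != 0.
    apply: contraNneq => W; have := q2 p.2; rewrite W => /eqP.
    by rewrite psumr_eq0 // => /allP/(_ p); rewrite mem_index_enum eqxx => /(_ isT).
  have comp p : q p != 0 -> [/\ [disjoint p.1 & p.2], g3 (p.1 :|: p.2) &
     st3 (p.1 :|: p.2) = g (st1 p.1) (st2 p.2)].
    by move=> qp; apply: Hcomp; [apply/wg1/qw1|apply/wg2/qw2].
  have m1P (P : pred {set E}) : \sum_(X | P X) w1 X = \sum_(p | P p.1) q p.
    rewrite (partition_big (fun p => p.1) P) //=; apply: eq_bigr => X PX.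
    rewrite -q1; apply: eq_bigl => p.
    by case: eqP => [->|]; rewrite ?PX ?andbF.
  have m2P (P : pred {set E}) : \sum_(X | P X) w2 X = \sum_(p | P p.2) q p.
    rewrite (partition_big (fun p => p.2) P) //=; apply: eq_bigr => X PX.
    rewrite -q2; apply: eq_bigl => p.
    by case: eqP => [->|]; rewrite ?PX ?andbF.
  have totw : \sum_X \sum_(p | p.1 :|: p.2 == X) q p = \sum_p q p.
    by rewrite (pushsum (fun p : {set E} * {set E} => p.1 :|: p.2) q predT).
  exists (fun X => \sum_(p | p.1 :|: p.2 == X) q p); split.
  + by move=> X; apply: sumr_ge0.
  + move=> X; apply: contraNT => nX; rewrite big1 // => p /eqP E0.
    by apply/eqP/negPn/negP => /comp[_ + _]; rewrite E0 (negPf nX).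
  + move=> s; rewrite (pushsum (fun p : {set E} * {set E} => p.1 :|: p.2) q (fun X => st3 X == s)).
    rewrite dot_case_sum3 !dot0 !add0r dot_ind.
    rewrite -(pushsum ev y3 (fun t => g t.1 t.2 == s)) -qP /=.
    rewrite big_mkcond [RHS]big_mkcond /=; apply: eq_bigr => p _.
    have [->|qp] := eqVneq (q p) 0; first by rewrite !if_same.
    by have [_ _ ->] := comp p qp.
  + move=> e; rewrite (pushsum (fun p : {set E} * {set E} => p.1 :|: p.2) q (fun X : {set E} => e \in X)).
    rewrite dot_case_sum3 dot0 addr0 wE1 wE2 (m1P (fun X : {set E} => e \in X)) (m2P (fun X : {set E} => e \in X)).
    rewrite big_mkcond [X in _ + X]big_mkcond [RHS]big_mkcond -big_split /=.
    apply: eq_bigr => p _.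
    have [->|qp] := eqVneq (q p) 0; first by rewrite !if_same addr0.
    have [dj _ _] := comp p qp; rewrite inE.
    case: (boolP (e \in p.1)) => e1; case: (boolP (e \in p.2)) => e2; rewrite ?addr0 ?add0r //.
    by have := disjointFr dj e1; rewrite e2.
  + rewrite totw; case=> [[j|j]|k].
    * by have := wB1 j; rewrite (m1P predT).
    * by have := wB2 j; rewrite (m2P predT).
    * have := qP predT; rewrite (pushsum ev y3 predT) => ->.
      by rewrite (bigD1 k) //= lerDl sumr_ge0.
- move=> X /Hdec[X1 [X2 [gX1 gX2 EX]]].
  have [dj gX sX] := Hcomp _ _ gX1 gX2.
  have [y1 [y10 Cy1 Ly1 Ey1]] := cpl1 _ gX1.
  have [y2 [y20 Cy2 Ly2 Ey2]] := cpl2 _ gX2.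
  have inA : (st1 X1, st2 X2) \in setX A1 A2 by rewrite inE HA1 // HA2.
  pose k0 : K := enum_rank_in inA (st1 X1, st2 X2).
  have ek0 : ev k0 = (st1 X1, st2 X2) by rewrite /ev enum_rankK_in.
  pose y3 k : R := (k == k0)%:R.
  have sum3 (P : pred (S1 * S2)) : dot (fun k => (P (ev k))%:R) y3 = (P (st1 X1, st2 X2))%:R.
    rewrite dot_ind big_mkcond (bigD1 k0) //= ek0 big1 ?addr0.
      by rewrite /y3 eqxx; case: (P _).
    by move=> k /negPf nk; rewrite /y3 nk if_same.
  exists (case_sum3 y1 y2 y3); split.
  + by case=> [[j|j]|k] /=; rewrite ?y10 ?y20 ?ler0n.
  + case=> [[i|i]|[s|s]]; rewrite dot_case_sum3 /=.
    * by rewrite !dot0 !addr0 Cy1.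
    * by rewrite !dot0 add0r addr0 Cy2.
    * rewrite dot0 addr0 dotN Ly1 (sum3 (fun t => t.1 == s)) /=.
      by rewrite addNr.
    * rewrite dot0 add0r dotN Ly2 (sum3 (fun t => t.2 == s)) /=.
      by rewrite addNr.
  + move=> s; rewrite dot_case_sum3 !dot0 !add0r (sum3 (fun t => g t.1 t.2 == s)) /=.
    by rewrite EX sX.
  + move=> e; rewrite dot_case_sum3 dot0 addr0 /= Ey1 Ey2 EX inE.
    case: (boolP (e \in X1)) => e1; case: (boolP (e \in X2)) => e2; rewrite ?addr0 ?add0r //.
    by have := disjointFr dj e1; rewrite e2.
Qed.

End Rep.

(** * Partial solutions on a piece of the graph *)

Section Pieces.
Variable V : finType.
Variable v0 : V.
Implicit Types (X Y : {set {set V}}) (B D : {set V}).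

(* The edges, the boundary and the interior of a part of a graph; interior vertices
   are meant to have all their incident edges in [pE]. *)
Record piece := Piece { pE : {set {set V}}; pB : {set V}; pI : {set V} }.

Definition piece_wf p := [disjoint pI p & pB p] /\
  forall e, e \in pE p -> e \subset pI p :|: pB p.

Definition compat p q := [/\ [disjoint pE p & pE q],
  [disjoint pI p & pI q :|: pB q] & [disjoint pI q & pI p :|: pB p]].

(** Interior vertices receive no further edges, so a component cut off from the boundary could never
    be connected to the rest. *)
Definition piece_sol p : pred {set {set V}} := fun X => (X \subset pE p) &&
  [forall v in pI p, (#|nbrs X v| == 2) && [exists u in pB p, connect (xadj X) v u]].

Definition cap3 (n : nat) : 'I_4 := inord (minn 3 n).

Lemma val_cap3 n : cap3 n = minn 3 n :> nat.
Proof. by rewrite /cap3 inordK // ltnS geq_minl. Qed.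

Lemma cap3_eq2 n : (cap3 n == cap3 2) = (n == 2).
Proof. by rewrite -val_eqE /= !val_cap3; lia. Qed.

Lemma cap3D m n : cap3 (cap3 m + cap3 n) = cap3 (m + n).
Proof. by apply: val_inj; rewrite /= !val_cap3; lia. Qed.

(* Outside B, and only there, the value is the junk value v0. *)
Definition rootf B (e : rel V) : {ffun V -> V} :=
  [ffun v => if v \in B then odflt v0 [pick u in B | connect e v u] else v0].

Definition eqr B (f : V -> V) : rel V := fun u v => [&& u \in B, v \in B & f u == f v].

Definition boundary_state : Type := ({ffun V -> 'I_4} * {ffun V -> V})%type.

Definition piece_state B X : boundary_state :=
  ([ffun v => if v \in B then cap3 #|nbrs X v| else ord0], rootf B (xadj X)).

Lemma rootf_eq B e u v : connect_sym e -> u \in B -> v \in B ->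
  (rootf B e u == rootf B e v) = connect e u v.
Proof.
move=> se uB vB; rewrite !ffunE uB vB; apply/eqP/idP => [|uv].
  case: pickP => [a /andP[aB ua]|/(_ u)]; last by rewrite /= uB connect0.
  case: pickP => [b /andP[bB vb]|/(_ v)]; last by rewrite /= vB connect0.
  by move=> /= E; apply: connect_trans ua _; rewrite E se.
by congr odflt; apply: eq_pick => a /=; rewrite (same_connect se uv).
Qed.

Lemma rootf_ext B e e' :
  (forall u v, u \in B -> v \in B -> connect e u v = connect e' u v) ->
  rootf B e = rootf B e'.
Proof.
move=> H; apply/ffunP => v; rewrite !ffunE; case: ifP => // vB.
congr odflt; apply: eq_pick => u /=.
by case: (boolP (u \in B)) => //= uB; rewrite H.
Qed.

Lemma eqr_rootf B X u v :
  eqr B (rootf B (xadj X)) u v = [&& u \in B, v \in B & connect (xadj X) u v].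
Proof.
rewrite /eqr; case: (boolP (u \in B)) => //= uB; case: (boolP (v \in B)) => //= vB.
by rewrite rootf_eq //; exact: connect_xadjC.
Qed.

Lemma connect_eqr B X u v : u \in B -> v \in B ->
  connect (eqr B (rootf B (xadj X))) u v = connect (xadj X) u v.
Proof.
move=> uB vB; apply/idP/idP; last by move=> uv; apply: connect1; rewrite eqr_rootf uB vB.
by apply: connect_sub => a b; rewrite eqr_rootf => /and3P[].
Qed.

Lemma connect_xadjS X Y u v : X \subset Y -> connect (xadj X) u v -> connect (xadj Y) u v.
Proof.
by move=> XY; apply: connect_sub => a b ab; apply: connect1; apply: (subsetP XY).
Qed.

Lemma pwf_adj p X u v : piece_wf p -> X \subset pE p -> xadj X u v ->
  (u \in pI p :|: pB p) && (v \in pI p :|: pB p).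
Proof.
by move=> [_ wf] sX /(subsetP sX) /wf /subsetP H; rewrite !H ?set21 ?set22.
Qed.

Lemma pwf_nb0 p X v : piece_wf p -> X \subset pE p -> v \notin pI p :|: pB p -> nbrs X v = set0.
Proof.
move=> wf sX vN; apply/setP => w; rewrite !inE; apply/negP => /(pwf_adj wf sX).
by rewrite (negPf vN).
Qed.

Lemma pwf_connect p X u v : piece_wf p -> X \subset pE p -> u \in pI p :|: pB p ->
  connect (xadj X) u v -> v \in pI p :|: pB p.
Proof.
move=> wf sX uP /connectP[q pq ->]; elim: q u uP pq => //= w q IH u uP /andP[uw pq].
by apply: IH pq; case/andP: (pwf_adj wf sX uw).
Qed.

Lemma nbU X1 X2 v : nbrs (X1 :|: X2) v = nbrs X1 v :|: nbrs X2 v.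
Proof. by apply/setP => w; rewrite !inE /xadj !inE. Qed.

Lemma card_nbU X1 X2 v : [disjoint X1 & X2] -> #|nbrs (X1 :|: X2) v| = #|nbrs X1 v| + #|nbrs X2 v|.
Proof.
move=> dj; rewrite nbU cardsU; set I := _ :&: _; suff -> : I = set0 by rewrite cards0 subn0.
apply/setP => w; rewrite !inE; apply/negP => /andP[w1 w2].
by have := disjointFr dj w1; rewrite -/(xadj X2 v w) w2.
Qed.

Lemma disjN B D v : [disjoint B & D] -> ~~ ((v \in B) && (v \in D)).
Proof. by move=> dj; apply/negP => /andP[/(disjointFr dj) ->]. Qed.

Definition joinr B1 (f1 : V -> V) B2 (f2 : V -> V) : rel V :=
  fun u v => eqr B1 f1 u v || eqr B2 f2 u v.

Definition pjoin p q := Piece (pE p :|: pE q) (pB p :|: pB q) (pI p :|: pI q).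

Lemma compat_sym p q : compat p q -> compat q p.
Proof. by case=> a b c; split=> //; rewrite disjoint_sym. Qed.

Lemma pjoin_wf p q : piece_wf p -> piece_wf q -> compat p q -> piece_wf (pjoin p q).
Proof.
move=> [dp wp] [dq wq] [_ d1 d2]; split; last first.
  move=> e; rewrite inE => /orP[/wp|/wq] /subsetP H; apply/subsetP => v /H;
    by rewrite !inE => /orP[] ->; rewrite ?orbT.
rewrite -setI_eq0; apply/eqP/setP => v; rewrite !inE.
move: (disjN v d1) (disjN v d2) (disjN v dp) (disjN v dq); rewrite !inE.
by case: (v \in pI p); case: (v \in pI q); case: (v \in pB p); case: (v \in pB q).
Qed.

(** A vertex of both pieces lies on both boundaries, so a path can change sides only at boundary
    vertices; cutting it there gives pieces that the two boundary relations record. *)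
Lemma connect_join p q X1 X2 u v : piece_wf p -> piece_wf q -> compat p q ->
  X1 \subset pE p -> X2 \subset pE q -> u \in pB p :|: pB q -> v \in pB p :|: pB q ->
  connect (xadj (X1 :|: X2)) u v =
  connect (joinr (pB p) (rootf (pB p) (xadj X1)) (pB q) (rootf (pB q) (xadj X2))) u v.
Proof.
move=> wp wq [_ d1 d2] s1 s2 uB vB; set J := joinr _ _ _ _; apply/idP/idP; last first.
  apply: connect_sub => a b; rewrite /J /joinr !eqr_rootf => /orP[]/and3P[_ _];
    by apply: connect_xadjS; rewrite ?subsetUl ?subsetUr.
have both w : w \in pI p :|: pB p -> w \in pI q :|: pB q -> (w \in pB p) && (w \in pB q).
  move=> w1 w2; move: (w1) (w2).
  rewrite !inE; case: (boolP (w \in pI p)) => [/(disjointFr d1)|_ /=]; first by rewrite w2.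
  by case: (boolP (w \in pI q)) => [/(disjointFr d2)|_ /=]; [rewrite w1|move=> -> ->].
case/connectP => ps; elim/last_ind: ps v vB => [|ps w' IH] v vB /= pth Ev.
  by rewrite Ev connect0.
(* Invariant: after the last change of sides, at a boundary vertex [y] already reached in [J], the
   path has stayed within one side. *)
suff K ps' w : path (xadj (X1 :|: X2)) u ps' -> w = last u ps' ->
   exists2 y, connect J u y & ((y \in pB p) && connect (xadj X1) y w) ||
      ((y \in pB q) && connect (xadj X2) y w).
  have [y uy /orP[]/andP[yB yv]] := K _ _ pth Ev.
    apply: connect_trans uy (connect1 _); rewrite /J /joinr !eqr_rootf yB yv andbT /=.
    have : v \in pI p :|: pB p by apply: pwf_connect yv => //; rewrite inE yB orbT.
    move=> vp; case: (boolP (v \in pB p)) => //= vN.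
    move: vB; rewrite inE (negPf vN) /= => vq.
    by have := both v vp; rewrite inE vq orbT (negPf vN) => /(_ isT).
  apply: connect_trans uy (connect1 _); rewrite /J /joinr !eqr_rootf yB yv andbT /=.
  have : v \in pI q :|: pB q by apply: pwf_connect yv => //; rewrite inE yB orbT.
  move=> vp; case: (boolP (v \in pB q)) => //= vN; first by rewrite orbT.
  move: vB; rewrite inE (negPf vN) orbF => vq.
  by have := both v _ vp; rewrite inE vq orbT (negPf vN) => /(_ isT).
elim/last_ind: ps' w {IH pth Ev} => [|ps' w0 IH] w.
  by move=> _ /= ->; exists u; rewrite ?connect0 ?andbT //; rewrite inE in uB.
rewrite rcons_path last_rcons => /andP[pth st] ->.
have [y uy yw] := IH _ pth erefl; set x := last u ps' in st yw *.
move: st; rewrite /xadj inE => /orP[st|st].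
  case/orP: yw => /andP[yB yx].
    by exists y => //; rewrite yB (connect_trans yx) //; apply: connect1.
  have xq : x \in pI q :|: pB q by apply: pwf_connect yx => //; rewrite inE yB orbT.
  have /andP[xp _] := pwf_adj wp s1 st.
  have /andP[xBp xBq] := both _ xp xq.
  exists x; last by rewrite xBp connect1.
  by apply: connect_trans uy (connect1 _); rewrite /J /joinr !eqr_rootf yB xBq yx orbT.
case/orP: yw => /andP[yB yx]; last first.
  by exists y => //; rewrite yB (connect_trans yx) ?orbT //; apply: connect1.
have xq : x \in pI p :|: pB p by apply: pwf_connect yx => //; rewrite inE yB orbT.
have /andP[xp _] := pwf_adj wq s2 st.
have /andP[xBp xBq] := both _ xq xp.
exists x; last by rewrite xBq (connect1 (st : xadj X2 x w0)) orbT.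
by apply: connect_trans uy (connect1 _); rewrite /J /joinr !eqr_rootf yB xBp yx.
Qed.

Definition joinst B1 B2 (s1 s2 : boundary_state) : boundary_state :=
  ([ffun v => if v \in B1 :|: B2 then cap3 (s1.1 v + s2.1 v) else ord0],
   rootf (B1 :|: B2) (joinr B1 s1.2 B2 s2.2)).

Lemma pst_deg p X v : piece_wf p -> X \subset pE p -> v \notin pI p ->
  (piece_state (pB p) X).1 v = cap3 #|nbrs X v|.
Proof.
move=> wf sX vI; rewrite ffunE; case: ifP => // vB.
rewrite (pwf_nb0 wf sX) ?inE ?(negPf vI) ?vB // cards0.
by apply: val_inj; rewrite /= val_cap3.
Qed.

Lemma pst_join p q X1 X2 : piece_wf p -> piece_wf q -> compat p q ->
  X1 \subset pE p -> X2 \subset pE q ->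
  piece_state (pB p :|: pB q) (X1 :|: X2) = joinst (pB p) (pB q) (piece_state (pB p) X1) (piece_state (pB q) X2).
Proof.
move=> wp wq cpq s1 s2; have [dE d1 d2] := cpq; congr pair; last first.
  by apply: rootf_ext => u v uB vB; apply: connect_join.
apply/ffunP => v; rewrite ffunE [RHS]ffunE; case: ifP => // vB.
have dX : [disjoint X1 & X2] by apply: disjointWl s1 _; apply: disjointWr s2 _.
have [[dp _] [dq _]] := (wp, wq).
have vI : (v \notin pI p) && (v \notin pI q).
  move: vB (disjN v d1) (disjN v d2) (disjN v dp) (disjN v dq); rewrite !inE.
  by case: (v \in pI p); case: (v \in pI q); case: (v \in pB p); case: (v \in pB q).
case/andP: vI => vp vq.
by rewrite !pst_deg // cap3D card_nbU.
Qed.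

Lemma pgood_join p q X1 X2 : piece_wf p -> piece_wf q -> compat p q ->
  piece_sol p X1 -> piece_sol q X2 -> piece_sol (pjoin p q) (X1 :|: X2).
Proof.
move=> wp wq [_ d1 d2] /andP[s1 /forall_inP g1] /andP[s2 /forall_inP g2].
apply/andP; split; first by rewrite setUSS.
apply/forall_inP => v; rewrite inE => /orP[vI|vI].
  have /andP[dg /exists_inP[u uB vu]] := g1 v vI.
  rewrite nbU (pwf_nb0 wq s2) ?(disjointFr d1) // setU0 dg /=.
  by apply/exists_inP; exists u; rewrite ?inE ?uB //; apply: connect_xadjS vu; rewrite subsetUl.
have /andP[dg /exists_inP[u uB vu]] := g2 v vI.
rewrite nbU (pwf_nb0 wp s1) ?(disjointFr d2) // set0U dg /=.
by apply/exists_inP; exists u; rewrite ?inE ?uB ?orbT //; apply: connect_xadjS vu; rewrite subsetUr.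
Qed.

(** All edges of [X] at an interior vertex of [p] belong to [p]. A path to the joint boundary,
    followed up to its first vertex on the boundary of [p], therefore uses only edges of [p]. *)
Lemma pgood_join_inv p q X : piece_wf p -> piece_wf q -> compat p q ->
  piece_sol (pjoin p q) X -> piece_sol p (X :&: pE p).
Proof.
move=> wp wq cpq; have [dE d1 d2] := cpq; case/andP=> sX /forall_inP gX.
apply/andP; split; first by rewrite subsetIr.
have noq v w : v \in pI p -> xadj X v w -> xadj (X :&: pE p) v w.
  move=> vI vw; rewrite /xadj inE; apply/andP; split=> //.
  have := subsetP sX _ vw; rewrite inE => /orP[//|inq].
  have /subsetP/(_ v) := wq.2 _ inq; rewrite set21 => /(_ isT).
  by rewrite (disjointFr d1).
apply/forall_inP => v vI.
have /andP[dg /exists_inP[u uB vu]] : (#|nbrs X v| == 2) && [exists u in pB p :|: pB q, connect (xadj X) v u].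
  by apply: gX; rewrite inE vI.
apply/andP; split.
  have -> : nbrs (X :&: pE p) v = nbrs X v.
    apply/setP => w; rewrite !inE; apply/idP/idP; last exact: noq.
    by rewrite /xadj inE => /andP[].
  by [].
have uN : u \notin pI p.
  apply/negP => uI; move: uB; rewrite inE (disjointFr wp.1 uI) /= => uq.
  by have := disjointFr d1 uI; rewrite inE uq orbT.
case/connectP: vu => ps; elim: ps v vI {dg} => [|w ps IH] v vI /=.
  by move=> _ E; rewrite E vI in uN.
move=> /andP[vw pth] Eu.
have vw' := noq _ _ vI vw.
have /andP[_] := pwf_adj wp (subsetIr X (pE p)) vw'.
rewrite inE => /orP[wI|wB]; last by apply/exists_inP; exists w => //; apply: connect1.
have /exists_inP[z zB wz] := IH w wI pth Eu.
by apply/exists_inP; exists z => //; apply: connect_trans wz; apply: connect1.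
Qed.

Definition boundary_states B : {set boundary_state} :=
  [set s : boundary_state | (s.1 \in pffun_on ord0 B predT) && (s.2 \in pffun_on v0 B (mem B))].

Lemma card_boundary_states B w : #|B| <= w -> #|boundary_states B| <= (4 * w) ^ w.
Proof.
move=> Bw.
have -> : #|boundary_states B| = 4 ^ #|B| * #|B| ^ #|B|.
  have := card_pffun_on (ord0 : 'I_4) (mem B) predT.
  rewrite (eq_card (B := 'I_4)) // card_ord => <-.
  rewrite -(card_pffun_on v0 (mem B) (mem B)) -cardX.
  by apply: eq_card => -[a b]; rewrite inE.
rewrite expnMn leq_mul ?leq_pexp2l //.
case: (posnP #|B|) => [->|B0]; first by case: w Bw => // w _; rewrite expn_gt0.
by apply: leq_trans (leq_pexp2l B0 Bw) _; rewrite leq_exp2r // (leq_trans B0).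
Qed.

Lemma pst_in B X : piece_state B X \in boundary_states B.
Proof.
rewrite inE; apply/andP; split; apply/pffun_onP; split=> //.
- by apply/subsetP => v; rewrite inE ffunE; case: ifP => //; rewrite eqxx.
- by apply/subsetP => v; rewrite inE ffunE; case: ifP => //; rewrite eqxx.
- move=> y /imageP[v vB ->]; rewrite ffunE; move: vB => /= vB; rewrite vB.
  by case: pickP => [u /andP[]|/(_ v)]; rewrite //= vB connect0.
Qed.

Definition pforget p D := Piece (pE p) (pB p :\: D) (pI p :|: D).

Lemma pforget_wf p D : piece_wf p -> D \subset pB p -> piece_wf (pforget p D).
Proof.
move=> [dp wp] sD; split.
  rewrite -setI_eq0; apply/eqP/setP => v; rewrite !inE.
  move: (disjN v dp).
  by case: (v \in pI p); case: (v \in pB p); case: (v \in D).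
move=> e /wp /subsetP H; apply/subsetP => v /H; rewrite !inE.
by case: (v \in pI p); case: (v \in pB p); case: (v \in D).
Qed.

Variable R : realType.

Definition piece_represents p m := represents R (piece_sol p) (piece_state (pB p)) m.

Lemma rep_leq (E St : finType) (good : pred {set E}) (st : {set E} -> St) m m' :
  m <= m' -> represents R good st m -> represents R good st m'.
Proof.
move=> mm [J [I [C [L [M [cJ a b]]]]]]; exists J, I, C, L, M; split=> //.
exact: leq_trans cJ mm.
Qed.

Lemma prep_join p q m1 m2 w : piece_wf p -> piece_wf q -> compat p q ->
  #|pB p| <= w -> #|pB q| <= w -> piece_represents p m1 -> piece_represents q m2 ->
  piece_represents (pjoin p q) (m1 + m2 + (4 * w) ^ w * (4 * w) ^ w).
Proof.
move=> wp wq cpq bp bq r1 r2.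
apply: (@rep_leq _ _ _ _ (m1 + m2 + #|boundary_states (pB p)| * #|boundary_states (pB q)|)).
  by rewrite leq_add2l leq_mul // card_boundary_states.
apply: (rep_join (g := joinst (pB p) (pB q)) r1 r2).
- by move=> X _; apply: pst_in.
- by move=> X _; apply: pst_in.
- move=> X1 X2 g1 g2; have [s1 s2] : X1 \subset pE p /\ X2 \subset pE q.
    by case/andP: g1 => -> _; case/andP: g2 => -> _.
  split; [|exact: pgood_join|exact: pst_join].
  by case: cpq => dE _ _; apply: disjointWl s1 _; apply: disjointWr s2 _.
- move=> X gX; exists (X :&: pE p), (X :&: pE q); split.
  + exact: pgood_join_inv gX.
  + apply: (@pgood_join_inv q p) => //; first exact: compat_sym.
    by move: gX; rewrite /pjoin setUC (setUC (pB p)) (setUC (pI p)).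
  + by rewrite -setIUr; apply/esym/setIidPl; case/andP: gX.
Qed.

(** The surviving states are those in which each vertex of [D] has degree 2 and is connected to a
    vertex that stays on the boundary; an interior vertex that reached only [D] then reaches the new
    boundary through it. *)
Lemma prep_forget p D m : piece_wf p -> D \subset pB p -> piece_represents p m -> piece_represents (pforget p D) m.
Proof.
move=> wp sD rp.
pose ok (s : boundary_state) := [forall v in D, (s.1 v == cap3 2) &&
  [exists u in pB p :\: D, s.2 v == s.2 u]].
pose h (s : boundary_state) : boundary_state := ([ffun v => if v \in pB p :\: D then s.1 v else ord0],
  rootf (pB p :\: D) (eqr (pB p) s.2)).
have sBD v : v \in pB p :\: D -> v \in pB p by rewrite inE => /andP[].
apply: (rep_restrict (ok := ok) (h := h) rp).
- move=> X; rewrite /piece_sol /=; case: (boolP (X \subset _)) => //= sX.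
  apply/forall_inP/andP => [H|[/forall_inP H /forall_inP K] v]; last first.
    rewrite inE; case: (boolP (v \in pI p)) => [vI _|vI /= vD].
      have /andP[-> /exists_inP[u uB vu]] := H v vI.
      case: (boolP (u \in D)) => uD; last by apply/exists_inP; exists u => //; rewrite inE uD.
      have /andP[_ /exists_inP[u' u'B uu']] := K u uD.
      apply/exists_inP; exists u' => //; apply: connect_trans vu _.
      by move: uu'; rewrite /= rootf_eq //; [exact: connect_xadjC|exact: sBD].
    have vB : v \in pB p by apply: (subsetP sD).
    have := K v vD; rewrite /= ffunE vB cap3_eq2 => /andP[-> /exists_inP[u uB vu]].
    apply/exists_inP; exists u => //.
    by move: vu; rewrite rootf_eq //; [exact: connect_xadjC|exact: sBD].
  split.
    apply/forall_inP => v vI; have := H v; rewrite inE vI => /(_ isT).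
    case/andP=> -> /exists_inP[u uB vu]; apply/exists_inP; exists u => //.
    exact: sBD.
  apply/forall_inP => v vD; have := H v; rewrite inE vD orbT => /(_ isT).
  have vB : v \in pB p by apply: (subsetP sD).
  rewrite /= ffunE vB cap3_eq2 => /andP[-> /exists_inP[u uB vu]].
  apply/exists_inP; exists u => //; rewrite rootf_eq //; first exact: connect_xadjC.
  exact: sBD.
- move=> X gX; congr pair.
    by apply/ffunP => v; rewrite ffunE [RHS]ffunE; case: ifP => // /sBD vB; rewrite ffunE vB.
  by apply: rootf_ext => u v uB vB; rewrite /= connect_eqr ?sBD.
Qed.

End Pieces.

(** * Eliminating the bags *)

Section Elimination.
Variables (V : finType) (v0 : V) (R : realType) (w : nat).
Notation piece := (piece V).
Notation cpiece := (piece * nat)%type.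
Implicit Types (p q : piece) (L : seq cpiece).

Let K := (4 * w) ^ w * (4 * w) ^ w.

Definition pieces_join L : piece := foldr (fun x t => pjoin x.1 t) (Piece set0 set0 set0) L.

Fixpoint pieces_ok L : Prop :=
  if L is x :: L' then
    [/\ piece_wf x.1, piece_represents v0 R x.1 x.2, compat x.1 (pieces_join L') & pieces_ok L']
  else True.

Fixpoint pieces_all (Q : piece -> Prop) L : Prop :=
  if L is x :: L' then Q x.1 /\ pieces_all Q L' else True.

(* The summand K prepays the join that will consume the piece. *)
Definition pieces_cost L := \sum_(x <- L) (x.2 + K).

Lemma pjoinCA p q r : pjoin p (pjoin q r) = pjoin q (pjoin p r).
Proof. by rewrite /pjoin /=; congr Piece; rewrite setUCA. Qed.

Lemma pjoinA p q r : pjoin p (pjoin q r) = pjoin (pjoin p q) r.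
Proof. by rewrite /pjoin /=; congr Piece; rewrite setUA. Qed.

Lemma disjointUr (T : finType) (A B C : {set T}) :
  [disjoint A & B :|: C] = [disjoint A & B] && [disjoint A & C].
Proof. by rewrite -!setI_eq0 setIUr setU_eq0. Qed.

Lemma disjointUl (T : finType) (A B C : {set T}) :
  [disjoint A :|: B & C] = [disjoint A & C] && [disjoint B & C].
Proof. by rewrite -!setI_eq0 setIUl setU_eq0. Qed.

Lemma compat_joinr p q r : compat p (pjoin q r) <-> compat p q /\ compat p r.
Proof.
rewrite /compat /pjoin /= !disjointUr !disjointUl.
split=> [[]|[[a b c] [d e f]]].
  by move=> /andP[-> ->] /andP[/andP[-> ->] /andP[-> ->]] /andP[/andP[-> ->] /andP[-> ->]].
move: b c e f => /andP[-> ->] /andP[-> ->] /andP[-> ->] /andP[-> ->].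
by rewrite a d.
Qed.

Lemma compat_joinl p q r : compat (pjoin p q) r <-> compat p r /\ compat q r.
Proof.
split=> [/compat_sym/compat_joinr[] /compat_sym ? /compat_sym ?|[a b]] //.
by apply/compat_sym/compat_joinr; split; apply/compat_sym.
Qed.

(** The selected pieces are merged into one, [None] if there are none. All boundaries involved stay
    inside [b], which bounds the cost of each join by [K]; one of the two joined pieces has prepaid
    it, so the total does not grow. *)
Lemma absorb (sel : pred piece) (b : {set V}) (Q : piece -> Prop) L :
  #|b| <= w -> pieces_ok L -> pieces_all (fun p => sel p -> pB p \subset b) L -> pieces_all Q L ->
  exists (o : option cpiece) (L2 : seq cpiece), let L' := oapp (cons^~ L2) L2 o in
  [/\ pieces_ok L', pieces_join L' = pieces_join L, pieces_cost L' <= pieces_cost L,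
      pieces_all (fun p => ~~ sel p /\ Q p) L2 & if o is Some x then pB x.1 \subset b else True].
Proof.
move=> bw; elim: L => [|[p m] L IH]; first by move=> _ _ _; exists None, [::].
move=> /= [wp rp cp okl] [selp sell] [Qp Ql].
have [op [L2 [ok2 tot2 pot2 all2 so]]] := IH okl sell Ql.
case: (boolP (sel p)) => sp; last first.
  case: op ok2 tot2 pot2 so => [[q mq]|] /= ok2 tot2 pot2 so.
    exists (Some (q, mq)), ((p, m) :: L2); case: ok2 => wq rq cq okL2; split=> //=.
    - split=> //; first by apply/compat_joinr; split=> //; apply/compat_sym;
        move: cp; rewrite -tot2 => /compat_joinr[].
      by split=> //; move: cp; rewrite -tot2 => /compat_joinr[].
    - by rewrite pjoinCA tot2.
    - by move: pot2; rewrite /pieces_cost !big_cons /=; lia.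
  exists None, ((p, m) :: L2); split=> //=.
  - by split=> //; rewrite tot2.
  - by rewrite tot2.
  - by move: pot2; rewrite /pieces_cost !big_cons /=; lia.
case: op ok2 tot2 pot2 so => [[q mq]|] /= ok2 tot2 pot2 so; last first.
  exists (Some (p, m)), L2; split=> //=.
  - by split=> //; rewrite tot2.
  - by rewrite tot2.
  - by move: pot2; rewrite /pieces_cost !big_cons /=; lia.
  - exact: selp.
case: ok2 => wq rq cq okL2; move: cp; rewrite -tot2 => /compat_joinr[cpq cpL].
exists (Some (pjoin p q, m + mq + K)), L2; split=> //=.
- split=> //; first exact: pjoin_wf.
  + apply: prep_join => //; apply: leq_trans bw; apply: subset_leq_card => //.
    exact: selp.
  + by apply/compat_joinl.
- by rewrite -pjoinA.
- by move: pot2; rewrite /pieces_cost !big_cons /=; lia.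
- by rewrite subUset selp.
Qed.

Lemma pieces_all_impl (Q Q' : piece -> Prop) L : (forall p, Q p -> Q' p) -> pieces_all Q L -> pieces_all Q' L.
Proof. by move=> H; elim: L => //= x L IH [/H ? /IH]. Qed.

Lemma pieces_join_disjoint (D : {set V}) L : pieces_all (fun p => [disjoint pB p & D]) L -> [disjoint pB (pieces_join L) & D].
Proof.
elim: L => /= [|x L IH [dx /IH dL]]; first by rewrite -setI_eq0 set0I.
by rewrite disjointUl dx.
Qed.

(* The vertices occurring only in the first bag can be forgotten once the pieces
   whose boundary contains one of them have been joined; the new boundary fits
   into a later bag by the running intersection property.  The vertex r, which
   belongs to all bags, is never forgotten: it witnesses global connectivity. *)
Lemma elimination (r : V) (bs : seq {set V}) L : running_intersection bs -> pieces_ok L -> bs != [::] ->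
  {in bs, forall b : {set V}, #|b| <= w /\ r \in b} ->
  pieces_all (fun p => exists2 b, b \in bs & pB p \subset b) L ->
  r \notin pI (pieces_join L) -> r \in pB (pieces_join L) ->
  exists q m, [/\ piece_wf q, piece_represents v0 R q m, m <= pieces_cost L, pE q = pE (pieces_join L) &
    pI q :|: pB q = pI (pieces_join L) :|: pB (pieces_join L) /\ pB q = [set r]].
Proof.
elim: bs L => // b [|b0 s] IH L.
  move=> _ okl _ Hb allB rI rB; have [bw rb] := Hb b (mem_head _ _).
  have sb : pieces_all (fun p => predT p -> pB p \subset b) L.
    by apply: pieces_all_impl allB => p [b']; rewrite inE => /eqP ->.
  have [op [L2 [ok2 tot2 pot2 all2 so]]] := absorb bw okl sb sb.
  case: L2 ok2 tot2 pot2 all2 => [|x L2] ok2 tot2 pot2 /=; last by case; case.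
  move=> _; case: op ok2 tot2 pot2 so => [[q m]|] /= ok2 tot2 pot2 so; last first.
    by move: rB; rewrite -tot2 inE.
  case: ok2 => wq rq _ _.
  have tq : pieces_join L = q.
    by rewrite -tot2 /pjoin !setU0; case: (q).
  rewrite tq in rI rB *.
  have sD : pB q :\ r \subset pB q by rewrite subD1set.
  exists (pforget q (pB q :\ r)), m; split=> //.
  - exact: pforget_wf.
  - exact: prep_forget.
  - by move: pot2; rewrite /pieces_cost big_cons big_nil /=; lia.
  split.
    apply/setP => v; rewrite !inE.
    by case: (v \in pI q); case: (v \in pB q); case: (v == r).
  by apply/setP => v; rewrite !inE; case: eqVneq => [->|]; case: (v \in pB q); rewrite ?rB.
move=> [[//|[b' b's Hb']] rips] okl _ Hb allB rI rB.
have [bw rb] := Hb b (mem_head _ _).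
pose D := [set v in b | all (fun b'' : {set V} => v \notin b'') (b0 :: s)].
have Ds v b'' : b'' \in b0 :: s -> v \in b'' -> v \notin D.
  by move=> b''s vb; rewrite inE; apply/negP => /andP[_ /allP/(_ _ b''s)]; rewrite vb.
have rD : r \notin D by apply: (Ds r b0); rewrite ?mem_head //; case: (Hb b0) => //; rewrite !inE eqxx orbT.
(* A piece whose boundary meets [D] can only be housed in [b], because [D] avoids all later bags. *)
have sb : pieces_all (fun p => ~~ [disjoint pB p & D] -> pB p \subset b) L.
  apply: pieces_all_impl allB => p [c]; rewrite inE => /orP[/eqP -> //|cs] pc.
  case/negP; rewrite -setI_eq0; apply/eqP/setP => v; rewrite !inE.
  apply/negP => /andP[vp vD]; have := Ds v c cs (subsetP pc _ vp).
  by rewrite inE vD.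
have [op [L2 [ok2 tot2 pot2 all2 so]]] := absorb (sel := fun p => ~~ [disjoint pB p & D]) bw okl sb allB.
have bD v : v \in b -> v \notin D -> v \in b'.
  move=> vb; rewrite inE vb andTb -has_predC => /hasP[c cs /=]; rewrite negbK => vc.
  exact: Hb' vb cs vc.
have allB2 : pieces_all (fun p => exists2 c, c \in b0 :: s & pB p \subset c) L2.
  apply: pieces_all_impl all2 => p [/negPn dj [c]].
  rewrite inE => /orP[/eqP ->|cs] pc; last by exists c.
  exists b' => //; apply/subsetP => v vp; apply: bD; first exact: (subsetP pc).
  by rewrite (disjointFr dj).
have Hbs : {in b0 :: s, forall c : {set V}, #|c| <= w /\ r \in c}.
  by move=> c cs; apply: Hb; rewrite inE cs orbT.
case: op ok2 tot2 pot2 so => [[q m]|] /= ok2 tot2 pot2 so; last first.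
  have [||q [m [wq rq mq eq1 eq2]]] := IH L2 rips ok2 isT Hbs allB2; rewrite ?tot2 //.
  by exists q, m; rewrite -tot2; split=> //; apply: leq_trans mq pot2.
case: ok2 => wq rq cq ok2.
pose D' := pB q :&: D.
have sD' : D' \subset pB q by rewrite subsetIl.
have dL2 : [disjoint pB (pieces_join L2) & D].
  by apply: pieces_join_disjoint; apply: pieces_all_impl all2 => p [/negPn].
have rI' : (r \notin pI q) && (r \notin pI (pieces_join L2)).
  by rewrite -negb_or; move: rI; rewrite -tot2 inE.
case/andP: rI' => rIq rIL.
have rBq : (r \in pB q) || (r \in pB (pieces_join L2)) by move: rB; rewrite -tot2 inE.
have [||||q' [m' [wq' rq' mq' eq1 eq2]]] := IH ((pforget q D', m) :: L2) rips _ isT Hbs.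
- split=> //=; first exact: pforget_wf.
    exact: prep_forget.
  case: cq => c1 c2 c3; split=> //=.
    rewrite disjointUl c2 /= -setI_eq0; apply/eqP/setP => v.
    move: (disjN v c3) (disjN v dL2); rewrite !inE.
    by case: (v \in pB q); case: (v \in pI (pieces_join L2)); case: (v \in pB (pieces_join L2));
      case: (v \in b); case: (all _ _); rewrite //= ?orbT.
  rewrite -setI_eq0; apply/eqP/setP => v.
  move: (disjN v c3); rewrite !inE.
  by case: (v \in pB q); case: (v \in pI (pieces_join L2)); case: (v \in pI q);
      case: (v \in b); case: (all _ _); rewrite //= ?orbT.
- split=> //=; exists b' => //; apply/subsetP => v; rewrite !inE.
  case: (boolP (v \in pB q)) => [vq|]; rewrite ?andbF //= !andbT => vD.
  by apply: bD; [exact: (subsetP so)|rewrite inE].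
- by rewrite /= !inE negb_or rIL andbT negb_or rIq /= negb_and (_ : _ && _ = false) ?orbT //;
    apply: negbTE; move: rD; rewrite inE.
- rewrite /= !inE; case/orP: rBq => ->; rewrite ?orbT //= andbT.
  by move: rD; rewrite inE => ->.
exists q', m'; split=> //.
- by apply: leq_trans mq' _; move: pot2; rewrite /pieces_cost !big_cons.
- by rewrite eq1 /= -tot2.
- case: eq2 => eq2 eq3; split=> //; rewrite eq2 -tot2 /=; apply/setP => v; rewrite !inE.
  by case: (v \in pI q); case: (v \in pB q); case: (v \in pI (pieces_join L2));
   case: (v \in pB (pieces_join L2)); case: (_ && all _ _).
Qed.

End Elimination.

(** * The upper bound *)

Section HamRep.
Variables (G : sgraph) (R : realType) (r : G).

Lemma prep_leaf (EA : {set {set G}}) (B : {set G}) :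
  piece_represents r R (Piece EA B set0) (2 ^ #|EA|).
Proof.
rewrite -card_powerset.
apply: (rep_restrict (ok := predT) (h := id) (rep_leaf R (powerset EA) (piece_state r B))) => // X.
rewrite /piece_sol /= inE andbT; case: (_ \subset _) => //=.
by apply/forall_inP => v; rewrite inE.
Qed.

(** Single vertices are pieces of their own, so that even an isolated vertex gets onto a boundary
    and is subjected to the degree condition. *)
Definition vpieces (vs : seq G) : seq (piece G * nat) :=
  [seq (Piece set0 [set v] set0, 1) | v <- vs].
Definition epieces (es : seq {set G}) : seq (piece G * nat) :=
  [seq (Piece [set e] e set0, 2) | e <- es].

Lemma join_epieces es : pI (pieces_join (epieces es)) = set0 /\ pE (pieces_join (epieces es)) = [set:: es].
Proof.
elim: es => /= [|e es [-> ->]]; first by split=> //; apply/setP => e; rewrite !inE.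
by split; [rewrite setU0|apply/setP => f; rewrite !inE].
Qed.

Lemma epieces_ok es : uniq es -> pieces_ok r R (epieces es).
Proof.
elim: es => //= e es IH /andP[ne /IH okes]; have [tI tE] := join_epieces es; split=> //=.
- split=> /=; first by rewrite -setI_eq0 set0I.
  by move=> f; rewrite inE => /eqP ->; rewrite set0U.
- by have := @prep_leaf [set e] e; rewrite cards1.
- split=> /=; rewrite ?tI ?tE -setI_eq0 ?set0I //.
  by rewrite setI_eq0 disjoints1 inE.
Qed.

Lemma join_vpieces vs L : [/\ pI (pieces_join (vpieces vs ++ L)) = pI (pieces_join L),
  pE (pieces_join (vpieces vs ++ L)) = pE (pieces_join L) &
  pB (pieces_join (vpieces vs ++ L)) = [set:: vs] :|: pB (pieces_join L)].
Proof.
elim: vs => /= [|v vs [-> -> ->]].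
  by split=> //; apply/setP => v; rewrite !inE.
by split; rewrite ?set0U // setUA; congr (_ :|: _); apply/setP => u; rewrite !inE.
Qed.

Lemma vpieces_ok vs L : pI (pieces_join L) = set0 -> pieces_ok r R L -> pieces_ok r R (vpieces vs ++ L).
Proof.
move=> tI okl; elim: vs => //= v vs IH; split=> //=.
- by split=> /=; [rewrite -setI_eq0 set0I|move=> e; rewrite inE].
- by have := @prep_leaf set0 [set v]; rewrite cards0.
- have [tI' tE' _] := join_vpieces vs L.
  by split=> /=; rewrite ?tI' ?tI -setI_eq0 ?set0I.
Qed.

Lemma pieces_all_cat (Q : piece G -> Prop) L1 L2 : pieces_all Q L1 -> pieces_all Q L2 -> pieces_all Q (L1 ++ L2).
Proof. by move=> H1 H2; elim: L1 H1 => //= x L IH [? /IH]. Qed.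

Lemma card_edges : #|edges G| <= #|G| ^ 2.
Proof.
have : edges G \subset [set [set p.1; p.2] | p : G * G].
  apply/subsetP => e /edgesP[u [v [_ ->]]]; apply/imsetP; by exists (u, v).
move/subset_leq_card => /leq_trans; apply; rewrite -mulnn -card_prod.
exact: leq_imset_card.
Qed.

Lemma ham_rep k : treewidth_at_most G k ->
  exists2 good : pred {set {set G}}, forall X, good X <-> HamiltonianCycle X &
    represents R good (fun _ => tt) (5 * (4 * k.+2) ^ (2 * k.+2) * #|G| ^ 2).
Proof.
move=> [T [bag [[[_ _ acT] tv te tc] bw]]].
have [l lT ripl] := tree_rip acT tc.
pose bag' t := r |: bag t.
have rip' (s : seq T) : running_intersection (map bag s) -> running_intersection (map bag' s).
  elim: s => //= t s IH [H /IH rips]; split=> //.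
  case: H => [H|[_ /mapP[t' t's ->] Ht']].
    by left; case: s H {IH rips}.
  right; exists (bag' t'); first exact: map_f.
  move=> v _ vb /mapP[t'' t''s ->]; rewrite !inE; case: eqP => //= vr vb''.
  apply: Ht' (map_f _ t''s) vb''.
  by move: vb; rewrite !inE; case: eqP vr.
pose L := vpieces (enum G) ++ epieces (enum (edges G)).
have [eI eE] := join_epieces (enum (edges G)).
have [vI vE vB] := join_vpieces (enum G) (epieces (enum (edges G))).
pose w := k.+2.
have [||||||q [m [wq rq mq qE [qV qB]]]] :=
  @elimination _ r R w r (map bag' l) L (rip' _ ripl).
- by apply: vpieces_ok => //; apply: epieces_ok; rewrite enum_uniq.
- have [t _] := tv r; have := lT t; by case: (l).
- move=> _ /mapP[t tl ->]; rewrite !inE eqxx; split=> //.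
  by rewrite cardsU1; have := bw t; case: (r \notin bag t) => /=; rewrite /w; lia.
- apply: pieces_all_cat.
    elim: (enum G) => //= v s IH; split=> //.
    have [t vt] := tv v; exists (bag' t); first exact: map_f.
    by rewrite sub1set !inE vt orbT.
  have : {subset enum (edges G) <= edges G} by move=> e; rewrite mem_enum.
  elim: (enum _) => //= e s IH sub; split; last by apply: IH => f fs; apply: sub; rewrite inE fs orbT.
  have /edgesP[u [v [uv ->]]] := sub e (mem_head _ _).
  have [t /andP[ut vt]] := te u v uv; exists (bag' t); first exact: map_f.
  by rewrite subUset !sub1set !inE ut vt !orbT.
- by rewrite vI eI inE.
- by rewrite vB !inE mem_enum.
have qE' : pE q = edges G by rewrite qE vE eE; apply/setP => e; rewrite inE mem_enum.
have qV' : pI q :|: pB q = setT.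
  by rewrite qV vI vB; apply/setP => v; rewrite !inE mem_enum ?orbT.
have qI v : (v \in pI q) = (v != r).
  have := congr1 (fun A : {set G} => v \in A) qV'; rewrite /= qB !inE; case: eqVneq => [-> _|_]; last by rewrite orbF.
  by apply/negP => /(disjointFr wq.1); rewrite qB inE eqxx.
(* The boundary is now {r}: reaching it means reaching [r], and the degree of [r] is the one
   condition still missing. *)
pose good X := piece_sol q X && ((piece_state r (pB q) X).1 r == cap3 2).
exists good.
  move=> X; rewrite /good qB /= ffunE inE eqxx cap3_eq2 hamiltonianP; split.
    case/andP=> /andP[sX /forall_inP gX] dr; rewrite qE' in sX.
    have cr v : connect (xadj X) v r.
      have [->|vr] := eqVneq v r; first exact: connect0.
      have := gX v; rewrite qI => /(_ vr) /andP[_ /exists_inP[u]].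
      by rewrite qB inE => /eqP ->.
    split=> //.
    + move=> v; have [->|vr] := eqVneq v r; first exact/eqP.
      by have := gX v; rewrite qI => /(_ vr) /andP[/eqP].
    + by move=> u v; apply: connect_trans (cr u) _; rewrite connect_xadjC.
    + by apply/card_gt0P; exists r.
  case=> sX dX cX _; rewrite dX eqxx andbT; apply/andP; split; first by rewrite qE'.
  apply/forall_inP => v _; rewrite dX eqxx /=; apply/exists_inP; exists r; rewrite ?cX //.
  by rewrite qB inE.
have rg : represents R good (fun _ => tt) m.
  by apply: (rep_restrict (ok := fun s : boundary_state G => s.1 r == cap3 2) (h := fun _ => tt) rq).
apply: rep_leq rg.
apply: leq_trans mq _; rewrite /pieces_cost big_cat !big_map /=.
rewrite !big_const_seq !count_predT -!cardE !iter_addn !addn0 -expnD addnn -mul2n.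
rewrite (_ : size (Finite.enum G) = #|G|); last by rewrite cardE enumT.
(* There are n pieces of cost 1 + K and at most n^2 of cost 2 + K, with K at least 1, hence the
   factor 5. *)
have K0 : 0 < (4 * w) ^ (2 * w) by rewrite expn_gt0.
have := card_edges; rewrite -/w; move: #|edges G| #|G| (_ ^ _) K0 => e n K K0.
rewrite -mulnn => en.
have : n <= n * n by case: (n) => // n'; rewrite leq_pmulr.
by move: (n * n) en => N en nN; nia.
Qed.

End HamRep.

(** * From linear descriptions to extended formulations *)

Section RepExt.
Variables (R : realType).
Local Open Scope ring_scope.

Lemma mulmx_dot (I : Type) (J : finType) p (F : I -> J -> R) (f : 'I_p -> I) (y : 'cV[R]_#|J|) i :
  ((\matrix_(i < p, j < #|J|) F (f i) (enum_val j)) *m y) i 0 =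
  dot (F (f i)) (fun j => y (enum_rank j) 0).
Proof.
rewrite mxE /dot (reindex (@enum_rank J)) /=; last by apply/onW_bij/enum_rank_bij.
by apply: eq_bigr => j _; rewrite mxE enum_rankK.
Qed.

Lemma dot_sum (J : finType) (c : J -> R) n (a : 'I_n -> R) (y : 'I_n -> J -> R) :
  dot c (fun j => \sum_i a i * y i j) = \sum_i a i * dot c (y i).
Proof.
rewrite /dot; under eq_bigr do rewrite mulr_sumr.
rewrite exchange_big /=; apply: eq_bigr => i _; rewrite mulr_sumr.
by apply: eq_bigr => j _; rewrite mulrCA.
Qed.

(** The cone is cut at total mass 1, which makes the measures convex combinations. Only the sign
    constraints are inequalities, one per variable; the bound of each variable by the total mass
    makes the slice bounded, hence a polytope. *)
Lemma rep_extension (P : edge_subset_problem) (G : sgraph) (good : pred {set {set G}}) m :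
  (forall X, good X <-> P G X) -> represents R good (fun _ => tt) m ->
  extension_complexity_at_most (@solution_polytope R P G) m%:R.
Proof.
move=> gP [J [I [C [L [M [cJ snd cpl]]]]]].
set d := #|edges G|.
pose Lm := \matrix_(i < d, j < #|J|) L (enum_val i : {set G}) (enum_val j).
pose Cm := \matrix_(i < #|I|, j < #|J|) C (enum_val i) (enum_val j).
pose Mm := \matrix_(i < 1, j < #|J|) M tt (enum_val j).
pose AA := row_mx (0 : 'M[R]_(#|J|, d)) (- 1%:M).
pose CC := col_mx (row_mx 1%:M (- Lm)) (col_mx (row_mx 0 Cm) (row_mx 0 Mm)).
pose cc := col_mx (0 : 'cV[R]_d) (col_mx (0 : 'cV[R]_#|I|) (const_mx 1 : 'cV[R]_1)).
pose Q : set 'cV[R]_(d + #|J|) :=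
  [set z : 'cV[R]_(d + #|J|) | (forall i, (AA *m z) i 0 <= (0 : 'cV[R]_#|J|) i 0) /\ CC *m z = cc]%classic.
pose yf (y : 'cV[R]_#|J|) j := y (enum_rank j) 0.
have QE x y : Q (col_mx x y) <-> [/\ forall j, 0 <= yf y j,
    forall i, dot (C i) (yf y) = 0, dot (M tt) (yf y) = 1 &
    forall i, x i 0 = dot (L (enum_val i)) (yf y)].
  rewrite /Q /= /AA /CC /cc mul_row_col mul0mx add0r mulNmx mul1mx.
  rewrite !mul_col_mx !mul_row_col !mul0mx !add0r mul1mx mulNmx.
  split=> [[yp /eq_col_mx[E1 /eq_col_mx[E2 E3]]]|[yp E2 E3 E1]].
    split.
    - by move=> j; have := yp (enum_rank j); rewrite !mxE oppr_le0.
    - move=> i; have := congr1 (fun A : 'cV_ _ => A (enum_rank i) 0) E2.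
      by rewrite /Cm mulmx_dot mxE enum_rankK.
    - have := congr1 (fun A : 'cV_ _ => A 0 0) E3.
      by rewrite /Mm (mulmx_dot (fun _ : 'I_1 => M tt) id) mxE.
    - move=> i; have := congr1 (fun A : 'cV_ _ => A i 0) E1.
      rewrite mxE [X in _ + X]mxE /Lm mulmx_dot [RHS]mxE => /eqP.
      by rewrite subr_eq0 => /eqP.
  split.
    by move=> i; have := yp (enum_val i); rewrite /yf enum_valK !mxE oppr_le0.
  congr col_mx; last congr col_mx; apply/matrixP => i j; rewrite (ord1 j).
  - by rewrite mxE [X in _ + X]mxE /Lm mulmx_dot E1 subrr mxE.
  - by rewrite /Cm mulmx_dot E2 mxE.
  - by rewrite /Mm (mulmx_dot (fun _ : 'I_1 => M tt) id) E3 mxE.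
have sndQ x y : Q (col_mx x y) -> exists w : {set {set G}} -> R,
   [/\ forall X, 0 <= w X, forall X, w X != 0 -> good X, \sum_X w X = 1,
       forall i, x i 0 = \sum_(X : {set {set G}} | enum_val i \in X) w X & forall i, yf y i <= 1].
  case/QE => yp yC yM yL; have [w [w0 wg wM wL wB]] := snd _ yp yC.
  have w1 : \sum_X w X = 1 by rewrite -yM wM.
  exists w; split=> //.
  - by move=> i; rewrite yL wL.
  - by move=> j; rewrite -w1.
exists #|J|, Q, #|J|; split; last by rewrite ler_nat.
- split.
    exists 1 => z; rewrite -[z]vsubmxK; move: (usubmx z) (dsubmx z) => x y Qz i.
    have [w [w0 wg w1 wx wy]] := sndQ _ _ Qz.
    have [yp _ _ _] := (QE _ _).1 Qz.
    case: (split_ordP i) => j ->; rewrite ?col_mxEu ?col_mxEd.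
      rewrite wx ger0_norm ?sumr_ge0 // -w1.
      by rewrite [leRHS](bigID (fun X : {set {set G}} => enum_val j \in X)) /= lerDl sumr_ge0.
    have := yp (enum_val j); have := wy (enum_val j); rewrite /yf enum_valK => ? ?.
    by rewrite ger0_norm.
  by exists (d + (#|I| + 1))%N, AA, 0, CC, cc.
- apply/seteqP; split=> x.
    move=> [n [v [a [Sv a0 a1 xE]]]].
    have /choice[Y HY] : forall i, exists y : J -> R, [/\ forall j, 0 <= y j,
        forall i, dot (C i) y = 0, dot (M tt) y = 1 &
        forall k, v i k 0 = dot (L (enum_val k)) y].
      move=> i; have [X PX vX] := Sv i; have [y [y0 yC yM yL]] := cpl X ((gP X).2 PX).
      exists y; split=> //.
      by move=> k; rewrite -vX mxE yL.
    pose y : 'cV[R]_#|J| := \col_k \sum_i a i * Y i (enum_val k).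
    have yfE : yf y = fun j => \sum_i a i * Y i j.
      by apply/funext => j; rewrite /yf mxE enum_rankK.
    exists (col_mx x y); last by rewrite col_mxKu.
    apply/QE; rewrite yfE; split.
    + by move=> j; apply: sumr_ge0 => i _; rewrite mulr_ge0 //; case: (HY i).
    + by move=> i; rewrite dot_sum big1 // => k _; have [_ -> _ _] := HY k; rewrite mulr0.
    + rewrite dot_sum -[RHS]a1; apply: eq_bigr => k _.
      by have [_ _ -> _] := HY k; rewrite mulr1.
    + move=> k; rewrite dot_sum xE summxE; apply: eq_bigr => i _.
      by rewrite mxE; have [_ _ _ ->] := HY i.
  move=> [z Qz <-]; rewrite -[z]vsubmxK in Qz.
  move: (usubmx z) (dsubmx z) Qz => {z} {}x y Qz.
  have [w [w0 wg w1 wx _]] := sndQ _ _ Qz.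
  pose gs := [set X : {set {set G}} | good X].
  exists #|gs|, (fun i => indicator R (enum_val i : {set {set G}})), (fun i => w (enum_val i)).
  have sumg (F : {set {set G}} -> R) : (forall X, ~~ good X -> F X = 0) ->
      \sum_(i < #|gs|) F (enum_val i) = \sum_X F X.
    move=> F0; rewrite -(big_enum_val F) [RHS](bigID (mem gs)) /= [X in _ + X]big1 ?addr0 //.
    by move=> X; rewrite inE; exact: F0.
  have wz X : ~~ good X -> w X = 0.
    by move=> nX; apply/eqP; apply: contraNT nX => /wg.
  split=> //.
  - move=> i; exists (enum_val i) => //; apply/gP.
    by have := enum_valP i; rewrite inE.
  - by rewrite sumg.
  - apply/matrixP => i j; rewrite (ord1 j) wx summxE.
    under [RHS]eq_bigr do rewrite !mxE.
    rewrite (sumg (fun X => w X * (enum_val i \in X)%:R)); last by move=> X /wz ->; rewrite mul0r.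
    rewrite big_mkcond; apply: eq_bigr => X _.
    by case: (_ \in _); rewrite ?mulr1 ?mulr0.
Qed.

End RepExt.

(** * The size of the formulation *)

Section Part1.
Variable R : realType.
Local Open Scope ring_scope.

(** For the empty graph the factor n^2 leaves no inequality at all; the empty polytope is described
    by the equation 0 = 1. *)
Lemma ham_ext0 (G : sgraph) : #|G| = 0%N ->
  extension_complexity_at_most (@solution_polytope R HamiltonianCycle G) 0.
Proof.
move=> G0.
exists 0%N, classical_sets.set0, 0%N; split=> //.
  split; first by exists 0 => z [].
  exists 1%N, 0, 0, 0, (const_mx 1); apply/seteqP; split=> z //=.
  case=> _; rewrite mul0mx => /matrixP/(_ 0 0); rewrite !mxE => /eqP.
  by rewrite eq_sym oner_eq0.
apply/seteqP; split=> x; last by case.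
case=> m [v [a [Sv _ a1 _]]]; case: m v a Sv a1 => [|m] v a Sv a1.
  by move: a1; rewrite big_ord0 => /eqP; rewrite eq_sym oner_eq0.
by have [X /hamiltonianP[_ _ _]] := Sv ord0; rewrite G0.
Qed.

Definition ham_size (k : nat) : nat := (5 * (4 * k.+2) ^ (2 * k.+2))%N.

Lemma ham_size_gt0 k : (0 < ham_size k)%N.
Proof. by rewrite muln_gt0 expn_gt0. Qed.

(** The exponent collects 5 <= k^2, 4 (k + 2) <= k^3 and 2 (k + 2) <= 4 k, that is 2 + 12 k <= 14
    k. *)
Lemma ham_size_le k : (3 <= k)%N -> (ham_size k <= k ^ (14 * k))%N.
Proof.
move=> k3; have k0 : (0 < k)%N by lia.
have h1 : (5 <= k ^ 2)%N by rewrite -mulnn; nia.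
have h2 : (4 * k.+2 <= k ^ 3)%N by rewrite !expnS expn0; nia.
have h3 : ((4 * k.+2) ^ (2 * k.+2) <= k ^ (3 * (4 * k)))%N.
  rewrite (expnM k 3); apply: (@leq_trans ((k ^ 3) ^ (2 * k.+2))%N); first by rewrite leq_exp2r //; lia.
  by rewrite leq_pexp2l ?expn_gt0 ?k0 //; lia.
apply: (@leq_trans (k ^ 2 * k ^ (3 * (4 * k)))%N); first by rewrite leq_mul.
by rewrite -expnD leq_pexp2l //; lia.
Qed.

Local Open Scope classical_set_scope.
Local Open Scope ring_scope.

Lemma upper_bound : exists (f : nat -> R) (c : nat),
  (f =O_\oo (fun k : nat => k%:R * ln k%:R : R)) /\
  has_extension_complexity HamiltonianCycle (fun k n => 2%:R `^ f k * n%:R ^+ c).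
Proof.
have ln2 : 0 < ln (2%:R : R) by rewrite ln_gt0 // ltr1n.
(* [f] is the exact binary logarithm of [ham_size], so the bound holds for every k, and the
   asymptotics concern [f] alone. *)
exists (fun k => ln (ham_size k)%:R / ln 2%:R), 2%N; split.
  apply/eqOP; near=> c; near=> k.
  have k3 : (3 <= k)%N by near: k; exists 3%N.
  have kR : 0 < k%:R :> R by rewrite ltr0n; lia.
  have hR : 0 < (ham_size k)%:R :> R by rewrite ltr0n ham_size_gt0.
  have lk : 0 <= ln k%:R :> R by rewrite ln_ge0 // ler1n; lia.
  have lh : 0 <= ln (ham_size k)%:R :> R by rewrite ln_ge0 // ler1n ham_size_gt0.
  have H : ln (ham_size k)%:R <= 14%:R * (k%:R * ln k%:R) :> R.
    have := ham_size_le k3; rewrite -(ler_nat R) natrX => h.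
    apply: le_trans (_ : ln (k%:R ^+ (14 * k)) <= _).
      by rewrite ler_ln ?posrE ?exprn_gt0.
    by rewrite lnXn // -[_ *+ (14 * k)%N]mulr_natl natrM mulrA.
  rewrite ger0_norm; last by rewrite divr_ge0 // ltW.
  rewrite ger0_norm; last by rewrite mulr_ge0 // ltW.
  rewrite ler_pdivrMr //.
  apply: le_trans H _; rewrite [leRHS]mulrAC.
  apply: ler_wpM2r; first by rewrite mulr_ge0 // ltW.
  rewrite -ler_pdivrMr //; near: c; exact: nbhs_pinfty_ge.
move=> k n G Gn tw.
have -> : 2%:R `^ (ln (ham_size k)%:R / ln 2%:R) = (ham_size k)%:R :> R.
  rewrite /powR pnatr_eq0 /= divfK ?gt_eqF // lnK // posrE ltr0n.
  exact: ham_size_gt0.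
rewrite -natrX -natrM.
have [n0|/card_gt0P[r _]] := posnP #|G|.
  by have := ham_ext0 n0; rewrite -Gn n0 muln0.
have [good gP rG] := ham_rep R r tw.
by have := rep_extension gP rG; rewrite /ham_size Gn.
Unshelve. all: by end_near. Qed.

End Part1.

(** * The lower bound: rectangle covers *)

Section RectangleCover.
Variable R : realType.
Local Open Scope ring_scope.

Lemma small_step (m : nat) (s t : 'I_m -> R) : (forall i, 0 < s i) ->
  exists2 e : R, 0 < e & forall i, e * t i <= s i.
Proof.
elim: m s t => [|m IH] s t s0; first by exists 1 => // -[].
have [e e0 He] := IH (fun i => s (lift ord0 i)) (fun i => t (lift ord0 i)) (fun i => s0 _).
have d0 : 0 < s ord0 / (1 + `|t ord0|) by rewrite divr_gt0 // ltr_pwDl.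
exists (Num.min e (s ord0 / (1 + `|t ord0|))); first by rewrite lt_min e0.
move=> i; case: (unliftP ord0 i) => [j ->|->].
  have [tp|tn] := leP 0 (t (lift ord0 j)).
    apply: le_trans (He j); apply: ler_wpM2r => //; by rewrite ge_min lexx.
  apply: le_trans (ltW (s0 _)); rewrite nmulr_lle0 // le_min ltW //= ltW //.
apply: (@le_trans _ _ (s ord0 / (1 + `|t ord0|) * `|t ord0|)).
  apply: (@le_trans _ _ (Num.min e (s ord0 / (1 + `|t ord0|)) * `|t ord0|)).
    by apply: ler_wpM2l; [rewrite le_min (ltW e0) ltW|exact: ler_norm].
  by apply: ler_wpM2r => //; rewrite ge_min lexx orbT.
rewrite -mulrA ger_pMr ?s0 // mulrC ler_pdivrMr ?ltr_pwDl // mul1r.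
by rewrite lerDr.
Qed.

(* Rectangle i consists of the faces on which inequality i is tight and of the
   points whose lift satisfies it strictly.  If a lift z satisfies with equality
   everything that is tight on a face, then one can move a little from a relative
   interior point of that face away from z without leaving Q, so z lies on the face. *)
Lemma rectangle_cover d (S : set 'cV[R]_d) (s : R) :
  extension_complexity_at_most (conv_hull S) s ->
  exists2 m : nat, m%:R <= s &
  forall (Ta Tb : Type) (l : Ta -> 'rV[R]_d) (c : Ta -> R) (x : Tb -> 'cV[R]_d),
    (forall a v, S v -> 0 <= (l a *m v) 0 0 + c a) ->
    (forall a, exists2 v, S v & (l a *m v) 0 0 + c a = 0) ->
    (forall b, S (x b)) ->
  exists (RA : 'I_m -> Ta -> bool) (RB : 'I_m -> Tb -> bool), forall a b,
    (0 < (l a *m x b) 0 0 + c a) <-> exists i, RA i a && RB i b.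
Proof.
move=> [r [Q [m [[_ [p [A [b0 [C [c0 QE]]]]]] PQ ms]]]]; exists m => //.
move=> Ta Tb l c x lval lface Sx.
have inP v : S v -> conv_hull S v.
  move=> Sv; exists 1%N, (fun _ => v), (fun _ => 1); split=> //; first by rewrite big_ord1.
  by rewrite big_ord1 scale1r.
have lift v : S v -> exists2 z, Q z & usubmx z = v by move/inP; rewrite PQ.
pose f a (z : 'cV[R]_(d + r)) := (l a *m usubmx z) 0 0 + c a.
have fQ a z : Q z -> 0 <= f a z.
  move=> Qz; have : conv_hull S (usubmx z) by rewrite PQ; exists z.
  case=> n [v [w [Sv w0 w1 E]]]; rewrite /f E mulmx_sumr summxE.
  rewrite (_ : c a = \sum_(i < n) w i * c a); last by rewrite -mulr_suml w1 mul1r.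
  rewrite -big_split /=; apply: sumr_ge0 => i _.
  by rewrite -scalemxAr mxE -mulrDr mulr_ge0 // lval.
have faff a (z z' : 'cV[R]_(d + r)) t : f a (z + t *: (z' - z)) = f a z + t * (f a z' - f a z).
  rewrite /f linearD linearZ linearB /= mulmxDr -scalemxAr mulmxBr !mxE; ring.
have Aaff k (N : 'M[R]_(k, d + r)) (z z' : 'cV[R]_(d + r)) t i :
   (N *m (z + t *: (z' - z))) i 0 = (N *m z) i 0 + t * ((N *m z') i 0 - (N *m z) i 0).
  by rewrite mulmxDr -scalemxAr mulmxBr !mxE.
have QP z : Q z <-> (forall i, (A *m z) i 0 <= b0 i 0) /\ C *m z = c0 by rewrite QE.
have /choice[zb Hzb] : forall b, exists z, Q z /\ usubmx z = x b.
  by move=> b; have [z ? ?] := lift _ (Sx b); exists z.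
pose RA i a := `[< forall z, Q z -> f a z = 0 -> (A *m z) i 0 = b0 i 0 >].
pose RB i b := (A *m zb b) i 0 < b0 i 0.
exists RA, RB => a b; have [Qb Eb] := Hzb b.
have fb : f a (zb b) = (l a *m x b) 0 0 + c a by rewrite /f Eb.
split=> [fpos|[i /andP[/asboolP RAi RBi]]]; last first.
  rewrite lt_def -fb fQ // andbT; apply/eqP => f0.
  by move: RBi; rewrite /RB RAi // ltxx.
apply: contrapT => nex.
have tight i : RA i a -> (A *m zb b) i 0 = b0 i 0.
  move=> RAi; apply/eqP; rewrite eq_le ((QP _).1 Qb).1 leNgt.
  by apply/negP => RBi; apply: nex; exists i; rewrite RAi.
have [v Sv vl] := lface a; have [z0 Qz0 Ez0] := lift v Sv.
have fz0 : f a z0 = 0 by rewrite /f Ez0.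
(* Repeated midpoints give a point of the face at which every inequality that is not tight on the
   whole face is strict. *)
have mid (js : seq 'I_m) : exists y, [/\ Q y, f a y = 0 &
    forall i, i \in js -> ~~ RA i a -> (A *m y) i 0 < b0 i 0].
  elim: js => [|i js [y [Qy fy ys]]]; first by exists z0.
  case: (boolP (RA i a)) => RAi.
    by exists y; split=> // j; rewrite inE => /orP[/eqP ->|/ys //]; rewrite RAi.
  have /asboolPn/existsNP[z /not_implyP[Qz /not_implyP[fz /eqP zi]]] := RAi.
  have zlt : (A *m z) i 0 < b0 i 0 by rewrite lt_neqAle zi ((QP _).1 Qz).1.
  exists (y + 2^-1 *: (z - y)); split.
  - apply/QP; split=> [j|].
      by have := ((QP _).1 Qz).1 j; have := ((QP _).1 Qy).1 j; rewrite Aaff; lra.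
    rewrite mulmxDr -scalemxAr mulmxBr ((QP _).1 Qz).2 ((QP _).1 Qy).2.
    by rewrite subrr scaler0 addr0.
  - by rewrite faff fy fz subrr mulr0 addr0.
  - move=> j; rewrite inE => jin RAj; rewrite Aaff.
    have := ((QP _).1 Qz).1 j; have := ((QP _).1 Qy).1 j.
    case/orP: jin => [/eqP ->|jin]; first by move: zlt => zlt; lra.
    by have := ys j jin RAj; lra.
have [y [Qy fy ys]] := mid (enum 'I_m).
have yt i : RA i a -> (A *m y) i 0 = b0 i 0 by move=> /asboolP; apply.
pose sl i := if RA i a then 1 else b0 i 0 - (A *m y) i 0.
have sl0 i : 0 < sl i.
  rewrite /sl; case: (boolP (RA i a)) => // RAi; rewrite subr_gt0.
  by apply: ys; rewrite ?mem_enum.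
have [e e0 He] := @small_step m sl
  (fun i => if RA i a then 0 else (A *m y) i 0 - (A *m zb b) i 0) sl0.
have : Q (y + (- e) *: (zb b - y)).
  apply/QP; split=> [i|].
    rewrite Aaff; have := He i; rewrite /sl; case: (boolP (RA i a)) => RAi; last by move=> H; lra.
    by move=> _; rewrite yt // tight // subrr mulr0 addr0.
  rewrite mulmxDr -scalemxAr mulmxBr ((QP _).1 Qb).2 ((QP _).1 Qy).2.
  by rewrite subrr scaler0 addr0.
move/(fQ a); rewrite faff fy subr0 add0r fb mulNr oppr_ge0 leNgt.
by rewrite mulr_gt0.
Qed.

End RectangleCover.

(** * Disjoint pairs in rectangles *)

Section UniqueDisjointness.
Implicit Types (A B : pred (seq bool)) (a b : seq bool).

Definition inter n a b := \sum_(i < n) (nth false a i && nth false b i).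

Lemma interS n x y a b : inter n.+1 (x :: a) (y :: b) = (x && y) + inter n a b.
Proof. by rewrite /inter big_ord_recl. Qed.

(** The number of disjoint pairs of length [n] in the rectangle of [A] and [B], split by first
    entries; the pair of entries (1, 1) is left out. *)
Fixpoint disj_pairs n A B : nat :=
  if n is n'.+1 then
    disj_pairs n' (A \o cons false) (B \o cons false) +
    disj_pairs n' (A \o cons false) (B \o cons true) +
    disj_pairs n' (A \o cons true) (B \o cons false)
  else A [::] && B [::].

(** Families of rectangles are compared through their covering multiplicities at each disjoint pair.
    This serves both to regroup the parts of one rectangle and to sum over a cover. *)
Lemma disj_pairs_sum n (m m' : nat) (A B : 'I_m -> pred (seq bool)) (A' B' : 'I_m' -> pred (seq bool)) :
  (forall a b, size a = n -> size b = n -> inter n a b = 0 ->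
    \sum_i (A i a && B i b) <= \sum_i (A' i a && B' i b)) ->
  \sum_i disj_pairs n (A i) (B i) <= \sum_i disj_pairs n (A' i) (B' i).
Proof.
elim: n A B A' B' => [|n IH] A B A' B' H.
  by apply: H => //; rewrite /inter big_ord0.
rewrite /= !big_split /=; apply: leq_add; first apply: leq_add.
all: by apply: IH => a b sa sb ab; apply: H; rewrite /= ?sa ?sb // interS ab.
Qed.

(* A disjoint pair (a, b) cannot extend both to (1a, _) in A and (_, 1b) in B, so the
   rectangle splits into (A0 u A1) x B0 and A0 x (B0 u B1). *)
Lemma disj_pairs_le n A B :
  (forall a b, size a = n -> size b = n -> A a -> B b -> inter n a b != 1) ->
  disj_pairs n A B <= 2 ^ n.
Proof.
elim: n A B => [|n IH] A B H; first exact: leq_b1.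
pose A0 := A \o cons false; pose A1 := A \o cons true.
pose B0 := B \o cons false; pose B1 := B \o cons true.
pose A01 a := A0 a || A1 a; pose B01 b := B0 b || B1 b.
apply: (@leq_trans (disj_pairs n A01 B0 + disj_pairs n A0 B01)).
  have := @disj_pairs_sum n 3 2 (fun i => if i < 2 then A0 else A1)
    (fun i => if i == 1 :> nat then B1 else B0)
    (fun i => if i == 0 :> nat then A01 else A0) (fun i => if i == 0 :> nat then B0 else B01).
  rewrite !big_ord_recr !big_ord0 /= !add0n; apply.
  move=> a b sa sb ab; rewrite !big_ord_recr !big_ord0 /= !add0n /A01 /B01.
  have : ~~ (A1 a && B1 b).
    apply/negP => /andP[Aa Bb]; have := H (true :: a) (true :: b).
    by rewrite /= sa sb interS ab => /(_ erefl erefl Aa Bb).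
  by case: (A0 a); case: (A1 a); case: (B0 b); case: (B1 b).
rewrite expnS mul2n -addnn; apply: leq_add; apply: IH => a b sa sb.
  move=> /orP[] Aa Bb.
    by have := H (false :: a) (false :: b); rewrite /= sa sb interS; apply.
  by have := H (true :: a) (false :: b); rewrite /= sa sb interS; apply.
move=> Aa /orP[] Bb.
  by have := H (false :: a) (false :: b); rewrite /= sa sb interS; apply.
by have := H (false :: a) (true :: b); rewrite /= sa sb interS; apply.
Qed.

Lemma disj_pairsT n : disj_pairs n predT predT = 3 ^ n.
Proof.
elim: n => //= n IH; have E c : predT \o cons c = predT :> pred (seq bool) by [].
by rewrite !E IH expnS; lia.
Qed.

Lemma udisj_cover n m (RA RB : 'I_m -> pred (seq bool)) :
  (forall i a b, size a = n -> size b = n -> RA i a -> RB i b -> inter n a b != 1) ->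
  (forall a b, size a = n -> size b = n -> inter n a b = 0 -> exists i, RA i a && RB i b) ->
  3 ^ n <= m * 2 ^ n.
Proof.
move=> H1 H2; rewrite -disj_pairsT.
have := @disj_pairs_sum n 1 m (fun _ => predT) (fun _ => predT) RA RB.
rewrite big_ord1 => /(_ _)/leq_trans; apply.
  move=> a b sa sb ab; rewrite big_ord1 /=; have [i Hi] := H2 a b sa sb ab.
  by rewrite (bigD1 i) //= Hi.
rewrite -[m in m * _]card_ord -sum_nat_const; apply: leq_sum => i _.
by apply: disj_pairs_le => a b; apply: H1.
Qed.

End UniqueDisjointness.

(** * The gadget graph *)

Section Cubic.
Variable V : finType.
Variables nu la ga : V -> V.
Hypothesis nuK : involutive nu.
Hypothesis laK : involutive la.
Hypothesis gaK : involutive ga.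
Hypothesis nu_neq : forall v, nu v != v.
Hypothesis la_neq : forall v, la v != v.
Hypothesis ga_neq : forall v, ga v != v.
Hypothesis nu_la : forall v, nu v != la v.
Hypothesis nu_ga : forall v, nu v != ga v.
Hypothesis la_ga : forall v, la v != ga v.

(** A cubic graph given by three disjoint perfect matchings. A Hamiltonian cycle containing the
    whole matching [nu] uses exactly one of the [la] and [ga] edges at each vertex, so its choice is
    constant along every cycle alternating between [la] and [ga]. *)
Definition cubic_adj : rel V := fun u v => [|| v == nu u, v == la u | v == ga u].

Lemma invol_eqC (f : V -> V) u v : involutive f -> (v == f u) = (u == f v).
Proof. by move=> fK; apply/eqP/eqP => ->; rewrite fK. Qed.

Lemma cubic_adj_sym : symmetric cubic_adj.
Proof.
by move=> u v; rewrite /cubic_adj (invol_eqC _ _ nuK) (invol_eqC _ _ laK) (invol_eqC _ _ gaK).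
Qed.

Lemma cubic_adj_irrefl : irreflexive cubic_adj.
Proof.
by move=> v; rewrite /cubic_adj !(eq_sym v) (negPf (nu_neq v)) (negPf (la_neq v)) (negPf (ga_neq v)).
Qed.

Definition cubic : sgraph := SGraph cubic_adj_sym cubic_adj_irrefl.

Lemma cubic_nu v : [set v; nu v] \in edges cubic.
Proof. by rewrite (@in_edges cubic) /= /cubic_adj eqxx. Qed.

Lemma cubic_la v : [set v; la v] \in edges cubic.
Proof. by rewrite (@in_edges cubic) /= /cubic_adj eqxx orbT. Qed.

Lemma cubic_ga v : [set v; ga v] \in edges cubic.
Proof. by rewrite (@in_edges cubic) /= /cubic_adj eqxx !orbT. Qed.

Section Sound.
Variable X : {set {set V}}.
Hypothesis hX : @HamiltonianCycle cubic X.
Hypothesis nuX : forall v, [set v; nu v] \in X.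
Let f v := [set v; la v] \in X.

Lemma cubic_gaX v : ([set v; ga v] \in X) = ~~ f v.
Proof.
have /hamiltonianP[sX dX _ _] := hX.
have E : nbrs X v = nu v |: ((if f v then [set la v] else set0) :|:
                  (if [set v; ga v] \in X then [set ga v] else set0)).
  apply/setP => w; rewrite !inE; apply/idP/idP => [vw|].
    have := subsetP sX _ vw; rewrite (@in_edges cubic) /= /cubic_adj.
    case/or3P => /eqP Ew; rewrite Ew ?eqxx // in vw *.
      by rewrite /f (_ : [set v; la v] \in X = true) //= !inE eqxx ?orbT.
    by rewrite (_ : [set v; ga v] \in X = true) //= !inE eqxx ?orbT.
  case/or3P => [/eqP -> //||]; first exact: nuX.
    by case: ifP; rewrite !inE // => fv /eqP ->.
  by case: ifP; rewrite !inE // => fv /eqP ->.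
have := dX v; rewrite E cardsU1.
case: (f v); case: ([set v; ga v] \in X) => //;
  rewrite ?setU0 ?set0U ?cards1 ?cards0 ?cards2 ?la_ga ?addn1 // !inE.
  by rewrite negb_or nu_la nu_ga.
by [].
Qed.

Lemma cubic_laf v : f (la v) = f v.
Proof. by rewrite /f laK setUC. Qed.

Lemma cubic_gaf v : f (ga v) = f v.
Proof. by rewrite -[LHS]negbK -[RHS]negbK -!cubic_gaX gaK setUC. Qed.

Lemma cubic_xadj u w : xadj X u w -> w = nu u \/ w = if f u then la u else ga u.
Proof.
have /hamiltonianP[sX _ _ _] := hX.
move=> uw; have := subsetP sX _ uw; rewrite (@in_edges cubic) /= /cubic_adj.
case/or3P => /eqP Ew; first by left.
  by right; rewrite Ew in uw *; rewrite /f (_ : _ \in _ = true).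
by right; rewrite Ew in uw *; have := cubic_gaX u; rewrite /xadj in uw; rewrite uw; case: (f u).
Qed.

End Sound.

Section Complete.
Variable f : V -> bool.
Hypothesis fla : forall v, f (la v) = f v.
Hypothesis fga : forall v, f (ga v) = f v.

Definition mate v := if f v then la v else ga v.

Definition cubic_sol : {set {set V}} :=
  [set e | [exists u, (e == [set u; nu u]) || (e == [set u; mate u])]].

Lemma mateK : involutive mate.
Proof.
by move=> v; rewrite /mate; case E: (f v); rewrite ?fla ?fga E ?laK ?gaK.
Qed.

Lemma cubic_sol_xadj u w : xadj cubic_sol u w = (w == nu u) || (w == mate u).
Proof.
rewrite /xadj inE; apply/existsP/idP => [[v /orP[]/eqP/set2_eq[][-> ->]]|].
- by rewrite eqxx.
- by rewrite nuK eqxx.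
- by rewrite eqxx orbT.
- by rewrite mateK eqxx orbT.
by case/orP => /eqP ->; exists u; rewrite eqxx ?orbT.
Qed.

Lemma cubic_sol_la v : ([set v; la v] \in cubic_sol) = f v.
Proof.
rewrite -/(xadj _ _ _) cubic_sol_xadj (eq_sym (la v)) (negPf (nu_la v)) /= /mate.
by case: (f v); rewrite ?eqxx // (negPf (la_ga v)).
Qed.

Lemma cubic_sol_ga v : ([set v; ga v] \in cubic_sol) = ~~ f v.
Proof.
rewrite -/(xadj _ _ _) cubic_sol_xadj (eq_sym (ga v)) (negPf (nu_ga v)) /= /mate.
by case: (f v); rewrite ?eqxx // eq_sym (negPf (la_ga v)).
Qed.

Lemma cubic_sol_nu v : [set v; nu v] \in cubic_sol.
Proof. by rewrite -/(xadj _ _ _) cubic_sol_xadj eqxx. Qed.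

Lemma cubic_sol_ham (v0 : V) : (forall v, connect (xadj cubic_sol) v v0) ->
  @HamiltonianCycle cubic cubic_sol.
Proof.
move=> conn; apply/hamiltonianP; split.
- apply/subsetP => e; rewrite inE => /existsP[u /orP[]/eqP ->]; first exact: cubic_nu.
  by rewrite /mate; case: (f u); [exact: cubic_la|exact: cubic_ga].
- move=> v; have -> : @nbrs cubic cubic_sol v = [set nu v; mate v].
    by apply/setP => w; rewrite !inE cubic_sol_xadj.
  rewrite cards2 /mate; case: (f v); by rewrite ?nu_la ?nu_ga.
- by move=> u v; apply: connect_trans (conn u) _; rewrite connect_xadjC.
- by apply/card_gt0P; exists v0.
Qed.

End Complete.
End Cubic.

(** * Rows, rings and toggles *)

Section Gadget.
Variable n' : nat.
Notation n := n'.+1.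

Lemma ordS_ind (P : 'I_n -> Prop) (i0 : 'I_n) :
  P i0 -> (forall i, P i -> P (ordS i)) -> forall i, P i.
Proof.
move=> P0 PS.
have H t : P (iter t (@ordS n) i0) by elim: t => //= t; apply: PS.
have it t : iter t (@ordS n) i0 = (i0 + t) %% n :> nat.
  elim: t => [|t IH]; first by rewrite addn0 modn_small.
  by rewrite iterS /= IH -addn1 modnDml -addnA addn1.
move=> i; suff -> : i = iter (n - i0 + i) (@ordS n) i0 by [].
apply: val_inj; rewrite /= it addnA subnKC; last exact: ltnW.
by rewrite modnDl modn_small.
Qed.

(* Row i is the cycle through In and Out of the places (i, j, c), in the order of
   [rho]: a Hamiltonian cycle through all forced edges [gnu] uses either all the
   edges [gla] of the row (the row is present) or all its edges [gga] (absent).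
   The places (i, j, c) and (j, i, c) form a ring that is connected to the outside
   by row i, by row j, or by a toggle, the 4-cycle U W W' U' at each of them, which
   switches between {U U', W W'} and {U W, U' W'}.  When both rows are present they
   swap strands, which the second copy c of the place undoes. *)
Definition place : Type := ('I_n * 'I_n * bool)%type.
Definition kind : Type := (option bool * bool)%type.
Definition gvert : Type := (place * kind)%type.

Definition kIn : kind := (Some true, false).
Definition kOut : kind := (Some true, true).
Definition kW : kind := (Some false, false).
Definition kW' : kind := (Some false, true).
Definition kU : kind := (None, false).
Definition kU' : kind := (None, true).

Definition rho (k : place) : place :=
  let: (i, j, c) := k in if c then (i, ordS j, false) else (i, j, true).
Definition rho' (k : place) : place :=
  let: (i, j, c) := k in if c then (i, j, false) else (i, ord_pred j, true).
(** Transposition makes rows i and j meet; the shift along the diagonal of the first copy ties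
    consecutive rows together. *)
Definition kappa (k : place) : place :=
  let: (i, j, c) := k in if (i == j) && ~~ c then (ordS i, ordS i, c) else (j, i, c).
Definition kappa' (k : place) : place :=
  let: (i, j, c) := k in if (i == j) && ~~ c then (ord_pred i, ord_pred i, c) else (j, i, c).

Lemma rhoK : cancel rho rho'.
Proof. by case=> [[i j] []] //=; rewrite ordSK. Qed.
Lemma rho'K : cancel rho' rho.
Proof. by case=> [[i j] []] //=; rewrite ord_predK. Qed.
Lemma kappaK : cancel kappa kappa'.
Proof.
case=> [[i j] c]; rewrite /kappa; case: ifP => H /=.
  by case/andP: H => /eqP <- cF; rewrite eqxx cF /= ordSK.
by rewrite eq_sym H.
Qed.
Lemma kappa'K : cancel kappa' kappa.
Proof.
case=> [[i j] c]; rewrite /kappa'; case: ifP => H /=.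
  by case/andP: H => /eqP <- cF; rewrite eqxx cF /= ord_predK.
by rewrite eq_sym H.
Qed.
Lemma rho_neq k : rho k != k.
Proof. by case: k => [[i j] []]; rewrite -pair_eqE /= andbF. Qed.
Lemma rho'_neq k : rho' k != k.
Proof. by case: k => [[i j] []]; rewrite -pair_eqE /= andbF. Qed.

Definition gnu (v : gvert) : gvert :=
  let: (k, t) := v in
  match t with
  | (Some true, true) => (k, kW)
  | (Some false, false) => (k, kOut)
  | (Some false, true) => (kappa k, kIn)
  | (Some true, false) => (kappa' k, kW')
  | (None, true) => (rho k, kU)
  | (None, false) => (rho' k, kU')
  end.

Definition gla (v : gvert) : gvert :=
  let: (k, t) := v in
  match t with
  | (Some true, true) => (rho k, kIn)
  | (Some true, false) => (rho' k, kOut)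
  | (Some false, s) => (k, (None, s))
  | (None, s) => (k, (Some false, s))
  end.

Definition gga (v : gvert) : gvert := let: (k, (t, s)) := v in (k, (t, ~~ s)).

Lemma gnuK : involutive gnu.
Proof. by case=> k [[[]|] []] //=; rewrite ?kappaK ?kappa'K ?rhoK ?rho'K. Qed.
Lemma glaK : involutive gla.
Proof. by case=> k [[[]|] []] //=; rewrite ?rhoK ?rho'K. Qed.
Lemma ggaK : involutive gga.
Proof. by case=> k [t s] //=; rewrite negbK. Qed.
Lemma gnu_neq v : gnu v != v.
Proof. by case: v => k [[[]|] []]; rewrite -pair_eqE /= ?andbF. Qed.
Lemma gla_neq v : gla v != v.
Proof. by case: v => k [[[]|] []]; rewrite -pair_eqE /= ?andbF. Qed.
Lemma gga_neq v : gga v != v.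
Proof. by case: v => k [[[]|] []]; rewrite -pair_eqE /= ?andbF. Qed.
Lemma gnu_la v : gnu v != gla v.
Proof. by case: v => k [[[]|] []]; rewrite -pair_eqE /= ?andbF. Qed.
Lemma gnu_ga v : gnu v != gga v.
Proof.
by case: v => k [[[]|] []]; rewrite -pair_eqE /= ?andbF ?andbT ?rho_neq ?rho'_neq.
Qed.
Lemma gla_ga v : gla v != gga v.
Proof.
by case: v => k [[[]|] []]; rewrite -pair_eqE /= ?andbF ?andbT ?rho_neq ?rho'_neq.
Qed.

Definition gadget : sgraph := cubic gnuK glaK ggaK gnu_neq gla_neq gga_neq.

Lemma card_gadget : #|gadget| = 12 * n ^ 2.
Proof.
rewrite /= !card_prod !card_ord card_option !card_bool -mulnn; lia.
Qed.

(* The rows in b are the absent ones; toggles fire where both rows are absent and,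
   to link consecutive rows, at the diagonal places of the first copy. *)
Definition gstate (b : seq bool) (v : gvert) : bool :=
  let: ((i, j, c), (t, _)) := v in
  if t is Some true then ~~ nth false b i
  else (nth false b i && nth false b j) || ((i == j) && ~~ c).

Lemma gstate_la b v : gstate b (gla v) = gstate b v.
Proof. by case: v => [[[i j] []] [[[]|] []]]. Qed.
Lemma gstate_ga b v : gstate b (gga v) = gstate b v.
Proof. by case: v => [[[i j] []] [[[]|] []]]. Qed.

Section Classes.
Variables (b : seq bool) (T : Type) (cl : gvert -> T).
Hypothesis cl_nu : forall v, cl (gnu v) = cl v.
Hypothesis cl_mate : forall v, cl (mate gla gga (gstate b) v) = cl v.
Notation absent i := (nth false b (nat_of_ord i)).
Implicit Types (i j : 'I_n) (c s : bool).

Let q (i j : 'I_n) (c : bool) (t : kind) : T := cl ((i, j, c), t).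

Let cOW i j c : q i j c kOut = q i j c kW.
Proof. exact/esym/(cl_nu ((i, j, c), kOut)). Qed.
Let cWI i j c : i != j -> q i j c kW' = q j i c kIn.
Proof. by move=> ij; rewrite /q -(cl_nu ((i, j, c), kW')) /= (negPf ij). Qed.
Let cWI1 i : q i i true kW' = q i i true kIn.
Proof. by rewrite /q -(cl_nu ((i, i, true), kW')) /= andbF. Qed.
Let cWI0 i : q i i false kW' = q (ordS i) (ordS i) false kIn.
Proof. by rewrite /q -(cl_nu ((i, i, false), kW')) /= eqxx. Qed.
Let cUU0 i j : q i j false kU' = q i j true kU.
Proof. exact/esym/(cl_nu ((i, j, false), kU')). Qed.
Let cUU1 i j : q i j true kU' = q i (ordS j) false kU.
Proof. exact/esym/(cl_nu ((i, j, true), kU')). Qed.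
Let cAbs i j c : absent i -> q i j c kIn = q i j c kOut.
Proof. by move=> ai; rewrite /q -(cl_mate ((i, j, c), kIn)) /mate /= ai. Qed.
Let cPre0 i j : ~~ absent i -> q i j false kOut = q i j true kIn.
Proof. by move=> ai; rewrite /q -(cl_mate ((i, j, false), kOut)) /mate /= ai. Qed.
Let cPre1 i j : ~~ absent i -> q i j true kOut = q i (ordS j) false kIn.
Proof. by move=> ai; rewrite /q -(cl_mate ((i, j, true), kOut)) /mate /= ai. Qed.
Let cOn i j c : gstate b ((i, j, c), kU) ->
  q i j c kU = q i j c kW /\ q i j c kU' = q i j c kW'.
Proof.
by move=> /= on; rewrite /q -(cl_mate ((i, j, c), kU)) -(cl_mate ((i, j, c), kU')) /mate /= on.
Qed.
Let cOff i j c : gstate b ((i, j, c), kU) = false ->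
  q i j c kU = q i j c kU' /\ q i j c kW = q i j c kW'.
Proof.
by move=> /= on; rewrite /q -(cl_mate ((i, j, c), kU)) -(cl_mate ((i, j, c), kW)) /mate /= on.
Qed.
Let on2 i j c : absent i -> absent j -> gstate b ((i, j, c), kU).
Proof. by move=> /= -> ->. Qed.
Let off2 i j c : i != j -> absent i && absent j = false -> gstate b ((i, j, c), kU) = false.
Proof. by move=> /= ij ->; rewrite (negPf ij). Qed.

(** The label of the track of row [i], which runs through the vertices U and U' of its places. *)
Let m i := q i i true kU'.

(** If both rows are absent, the toggles of one copy exchange the tracks of [i] and [j], and those
    of the other copy exchange them back. Otherwise the toggles are off and the track runs straight
    on. *)
Let main_step i j : i != j -> q i j false kU = q i j true kU'.
Proof.
move=> ij; have ji : j != i by rewrite eq_sym.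
case ab: (absent i && absent j).
  case/andP: ab => ai aj.
  have := cOn (on2 false ai aj); have := cOn (on2 true ai aj).
  have := cOn (on2 false aj ai); have := cOn (on2 true aj ai).
  have := cOW i j false; have := cAbs j false ai; have := cWI false ji.
  have := cUU0 j i; have := cOW j i true; have := cAbs i true aj; have := cWI true ij.
  by do 7!move=> ?; do 4!case=> ? ?; congruence.
have [? _] := cOff (off2 false ij ab); have [? _] := cOff (off2 true ij ab).
by have := cUU0 i j; congruence.
Qed.

Let main_diag i : q i i true kU = m i.
Proof.
rewrite /m; case ai: (absent i).
  have [? ?] := cOn (on2 true ai ai).
  have := cOW i i true; have := cAbs i true ai; have := cWI1 i; congruence.
have [] // := @cOff i i true; by rewrite /= ai eqxx.
Qed.

Let main_U' i j : q i j true kU' = m i.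
Proof.
move: j; apply: (@ordS_ind _ i) => // j IH.
have [<-//|ij] := eqVneq i (ordS j).
by rewrite -main_step // -cUU1.
Qed.

Let main_U i j : q i j false kU = m i.
Proof. by rewrite -(main_U' i (ord_pred j)) cUU1 ord_predK. Qed.

Let swap i j c : i != j -> ~~ absent i -> q i j c kIn = q j i c kOut.
Proof.
move=> ij ai; have ji : j != i by rewrite eq_sym.
have := cWI c ji; have := cOW j i c.
have [|_] := @cOff j i c; first by rewrite off2 // (negPf ai) andbF.
by congruence.
Qed.

Let swapA i j c : i != j -> ~~ absent i -> absent j ->
  q i j c kIn = q i j c kOut.
Proof.
move=> ij ai aj; have ji : j != i by rewrite eq_sym.
have := swap c ij ai; have := cAbs i c aj; have := cWI c ij; have := cOW i j c.
have [|_] := @cOff i j c; first by rewrite off2 // (negPf ai).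
by congruence.
Qed.

(** If row [j] is absent, the strand goes once round each ring and stays in row [i]; if it is
    present, the strand changes to row [j] and returns at the second copy. *)
Let row_step i j : i != j -> ~~ absent i ->
  q i j false kIn = q i j true kOut.
Proof.
move=> ij ai; have ji : j != i by rewrite eq_sym.
case aj: (absent j).
  by have := swapA false ij ai aj; have := swapA true ij ai aj; have := cPre0 j ai; congruence.
have := swap false ij ai; have := swap true ji (negbT aj); have := cPre0 i (negbT aj).
by congruence.
Qed.

Let diag_out i : q i i false kOut = m i.
Proof.
have [|? _] := @cOn i i false; first by rewrite /= eqxx orbT.
by have := cOW i i false; have := main_U i i; congruence.
Qed.

Let row_out i j : ~~ absent i -> q i j true kOut = m i.
Proof.
move=> ai; move: j; apply: (@ordS_ind _ i).
  have [|_ ?] := @cOff i i true; first by rewrite /= (negPf ai) eqxx.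
  by have := diag_out i; have := cPre0 i ai; have := cWI1 i; have := cOW i i true; congruence.
move=> j IH; have [<-|ij] := eqVneq i (ordS j); last by rewrite -row_step // -cPre1.
have [|_ ?] := @cOff i i true; first by rewrite /= (negPf ai) eqxx.
by have := diag_out i; have := cPre0 i ai; have := cWI1 i; have := cOW i i true; congruence.
Qed.

Let row_in i j : ~~ absent i -> q i j false kIn = m i.
Proof. by move=> ai; rewrite -(row_out (ord_pred j) ai) cPre1 // ord_predK. Qed.

(** The diagonal toggle of the first copy is always on and leads from the track of row [i] to the
    vertex In of the next diagonal place. *)
Let link i : m (ordS i) = m i.
Proof.
have [|_ ?] := @cOn i i false; first by rewrite /= eqxx orbT.
have : q (ordS i) (ordS i) false kIn = m i.
  by have := cWI0 i; have := cUU0 i i; have := main_diag i; congruence.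
case ai: (absent (ordS i)); last by rewrite row_in // ai.
by rewrite cAbs // diag_out.
Qed.

Let mE i : m i = m ord0.
Proof. by move: i; apply: (@ordS_ind _ ord0) => // i IH; rewrite link. Qed.

Let all_U' i j : q i j false kU' = m ord0.
Proof.
have [<-|ij] := eqVneq i j; first by rewrite cUU0 main_diag mE.
have ji : j != i by rewrite eq_sym.
case ab: (absent i && absent j); last first.
  by have [? _] := cOff (off2 false ij ab); have := main_U i j; have := mE i; congruence.
case/andP: ab => ai aj.
have [_ ?] := cOn (on2 false ai aj); have [? _] := cOn (on2 false aj ai).
have := cWI false ij; have := cAbs i false aj; have := cOW j i false.
by have := main_U j i; have := mE j; congruence.
Qed.

Let all_present i j c s : ~~ absent i -> q i j c (Some true, s) = m ord0.
Proof.
move=> ai; have [[mi ro] ri] := (mE i, row_out j ai, row_in j ai); case: c; case: s.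
- by rewrite -mi.
- rewrite -cPre0 //; have [<-|ij] := eqVneq i j; first by rewrite diag_out.
  case aj: (absent j); first by have := swapA false ij ai aj; congruence.
  have := swap true ij ai; have := row_out i (negbT aj); have := cPre0 j ai; have := mE j.
  by congruence.
- rewrite -/kOut; have [<-|ij] := eqVneq i j; first by rewrite diag_out.
  case aj: (absent j); first by have := swapA false ij ai aj; congruence.
  have := swap true ij ai; have := row_out i (negbT aj); have := cPre0 j ai; have := mE j.
  by congruence.
- by rewrite -mi.
Qed.

Let all_kU i j c s : q i j c (None, s) = m ord0.
Proof.
case: c; case: s; first by rewrite main_U' mE.
- by rewrite -cUU0 all_U'.
- exact: all_U'.
- by rewrite main_U mE.
Qed.

Let all_row i j c s : q i j c (Some true, s) = m ord0.
Proof.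
case ai: (absent i); last by rewrite all_present // ai.
suff H : q i j c kOut = m ord0 by case: s => //; rewrite (cAbs j c ai).
case aj: (absent j).
  by have [? _] := cOn (on2 c ai aj); have := cOW i j c; have : q i j c kU = m ord0 := all_kU i j c false; congruence.
have ij : i != j by apply: contraTneq ai => ->; rewrite aj.
have [|_ ?] := @cOff i j c; first by rewrite off2 // aj andbF.
have := cWI c ij; have : q j i c kIn = m ord0 := @all_present j i c false (negbT aj); have := cOW i j c.
by congruence.
Qed.

(** This is connectivity, phrased for labellings that are constant along the used edges so that
    [congruence] can do the chasing; it is applied to the function that sends a vertex to the root
    of its component. *)
Lemma classes_all v : cl v = cl ((ord0, ord0, true), kU').
Proof.
case: v => [[[i j] c] [t s]]; rewrite -/(q i j c (t, s)) -/(q _ _ _ _) -[RHS]/(m ord0).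
case: t => [[]|].
- exact: all_row.
- case: s; last by rewrite -/kW; have := cOW i j c; have : q i j c kOut = m ord0 := all_row i j c true; congruence.
  rewrite -/kW'; have [<-|ij] := eqVneq i j.
    by case: c; [rewrite cWI1 all_row|rewrite cWI0 all_row].
  by rewrite cWI // all_row.
- exact: all_kU.
Qed.

End Classes.

Definition gsol b : {set {set gadget}} := cubic_sol gnu gla gga (gstate b).

Lemma gsol_ham b : @HamiltonianCycle gadget (gsol b).
Proof.
apply: (@cubic_sol_ham _ _ _ _ gnuK glaK ggaK gnu_neq gla_neq gga_neq gnu_la gnu_ga _
  (gstate_la b) (gstate_ga b) ((ord0, ord0, true), kU')).
move=> v; set X := cubic_sol _ _ _ _; have sX := @connect_xadjC gvert X.
apply/(fingraph.rootP sX); apply: (@classes_all b).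
  move=> u; apply/(fingraph.rootP sX)/connect1.
  rewrite xadj_sym cubic_sol_xadj ?eqxx //; [exact: gnuK|exact: glaK|exact: ggaK|exact: gstate_la|exact: gstate_ga].
move=> u; apply/(fingraph.rootP sX)/connect1.
by rewrite xadj_sym cubic_sol_xadj ?eqxx ?orbT //; [exact: gnuK|exact: glaK|exact: ggaK|exact: gstate_la|exact: gstate_ga].
Qed.

End Gadget.

(** * Two absent rows force a toggle *)

Section Cut.
Variable n' : nat.
Notation n := n'.+1.
Notation gadget := (gadget n').
Notation gvert := (gvert n').
Variable X : {set {set gadget}}.
Hypothesis hX : @HamiltonianCycle gadget X.
Hypothesis nuX : forall v : gvert, [set v; gnu v] \in X.
Let f (v : gvert) := [set v; gla v] \in X.

Lemma gadget_gaX (v : gvert) : ([set v; gga v] \in X) = ~~ f v.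
Proof. exact: (cubic_gaX (@gnu_la n') (@gnu_ga n') (@gla_ga n') hX nuX). Qed.

Lemma gadget_row (i j : 'I_n) (c : bool) : f ((i, j, c), kIn) = f ((i, i, false), kIn).
Proof.
have ga v : f (gga v) = f v.
  exact: (cubic_gaf (@gnu_la n') (@gnu_ga n') (@gla_ga n') hX nuX).
have la v : f (gla v) = f v by exact: (cubic_laf (@glaK n')).
have step k : f (rho k, kIn) = f (k, kIn).
  by rewrite -(ga (k, kIn)) -(la (k, kOut)).
suff H j0 : f ((i, j0, false), kIn) = f ((i, i, false), kIn).
  by case: c => //; rewrite -(H j) -(step (i, j, false)).
move: j0; apply: (@ordS_ind _ _ i) => // j0 IH.
by rewrite -IH -[LHS]/(f (rho (i, j0, true), kIn)) step
  -[(i, j0, true)]/(rho (i, j0, false)) step.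
Qed.

(* Otherwise no edge of X would leave the ring formed by the two places. *)
Lemma gadget_cut (i j : 'I_n) : i != j ->
  ~~ f ((i, i, false), kIn) -> ~~ f ((j, j, false), kIn) ->
  f ((i, j, false), kW) || f ((j, i, false), kW).
Proof.
move=> ij fi fj; have ji : j != i by rewrite eq_sym.
have ga v : f (gga v) = f v.
  exact: (cubic_gaf (@gnu_la n') (@gnu_ga n') (@gla_ga n') hX nuX).
apply/negPn/negP; rewrite negb_or => /andP[fij fji].
pose Z : pred gvert := fun v => ((v.1 == (i, j, false)) || (v.1 == (j, i, false))) && (v.2.1 != None).
have fZ v : Z v -> f v = false.
  have gs k t s : f (k, (t, s)) = f (k, (t, false)) by case: s => //; exact: (ga (k, (t, false))).
  case: v => k [[[]|] s] /andP[/orP[]/eqP /= -> _] //; apply: negbTE; rewrite gs //.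
  - by rewrite gadget_row.
  - by rewrite gadget_row.
(* On the ring only the edges [gnu] and [gga] are used, and both lead back into it. *)
have clZ : closed_mem (xadj X) (mem Z).
  apply: intro_closed; first exact/sym_connect_sym/xadj_sym.
  move=> u w uw uZ; have := @cubic_xadj _ _ _ _ _ _ _ _ _ _ (@gnu_la n') (@gnu_ga n') (@gla_ga n') _ hX nuX u w uw.
  rewrite -/(f u) (fZ u uZ) => -[] ->; move: uZ; rewrite !unfold_in /Z.
    case: u {uw} => k [[[]|] []] //= /andP[/orP[]/eqP -> _] //=;
      by rewrite ?(negPf ij) ?(negPf ji) /= !eqxx ?orbT.
  by case: u {uw} => k [t s].
have /hamiltonianP[_ _ conn _] := hX.
have := closed_connect clZ (conn ((i, j, false), kW) ((i, j, false), kU)).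
by rewrite !unfold_in /Z /= eqxx.
Qed.

End Cut.

(** * A path decomposition of the gadget graph *)

Section Treewidth.

Definition path_adj N : rel 'I_N := fun i j => (i.+1 == j) || (j.+1 == i).

Lemma path_adj_sym N : symmetric (@path_adj N).
Proof. by move=> i j; rewrite /path_adj orbC. Qed.

Lemma path_adj_irrefl N : irreflexive (@path_adj N).
Proof. by move=> i; rewrite /path_adj orbb; apply/negP => /eqP; lia. Qed.

Definition path_graph N : sgraph := SGraph (@path_adj_sym N) (@path_adj_irrefl N).

Lemma path_connect N (P : pred 'I_N) (s t : 'I_N) :
  (forall u : 'I_N, (minn s t <= u <= maxn s t) -> P u) ->
  connect [rel a b | [&& path_adj a b, P a & P b]] s t.
Proof.
wlog st : s t / s <= t.
  move=> H Pst; case: (leqP s t) => [|/ltnW] st; first exact: H.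
  rewrite (sym_connect_sym (e := [rel a b | [&& path_adj a b, P a & P b]])).
    by apply: H => // u; rewrite minnC maxnC; exact: Pst.
  by move=> a b /=; rewrite path_adj_sym; congr andb; rewrite andbC.
have [d] := ubnP (t - s); elim: d s st => // d IH s st dst Pst.
have [E|ne] := eqVneq s t; first by rewrite E connect0.
have lt : s < t by rewrite ltn_neqAle ne.
have s1 : s.+1 < N by apply: leq_ltn_trans lt (ltn_ord t).
pose s' := Ordinal s1.
have H : connect [rel a b | [&& path_adj a b, P a & P b]] s' t.
  by apply: IH => [||u Hu]; [exact: lt|rewrite /=; lia|apply: Pst; simpl in Hu; lia].
apply: connect_trans (connect1 _) H => /=.
by rewrite /path_adj /= eqxx /= !Pst //=; lia.
Qed.

(** On a cycle, both neighbours of the largest vertex would have to be the number just below it. *)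
Lemma path_tree N : 0 < N -> is_tree (path_graph N).
Proof.
move=> N0; split; first by rewrite /= card_ord.
  move=> s t; apply: connect_sub (@path_connect N predT s t (fun _ _ => isT)) => a b /= /andP[ab _].
  exact: connect1.
move=> c /andP[cy uc]; rewrite ltnNge; apply/negP => sc.
have [x0 x0c] : exists x, x \in c by case: (c) sc => // x ? _; exists x; rewrite mem_head.
case: (arg_maxnP (fun x : 'I_N => val x) x0c) => x xc xmax.
have a1 := next_cycle cy xc; have a2 := prev_cycle cy xc.
have nc : next c x \in c by rewrite mem_next.
have pc : prev c x \in c by rewrite mem_prev.
have := xmax _ nc; have := xmax _ pc; rewrite /= /path_adj /= in a1 a2 *.
have K (a b z : nat) : (z.+1 == a) || (a.+1 == z) -> (b.+1 == z) || (z.+1 == b) ->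
  b <= z -> a <= z -> a = b by lia.
move=> l2 l1; have E := K _ _ _ a1 a2 l2 l1.
by have := next_next_neq uc sc xc; rewrite (val_inj E) next_prev // eqxx.
Qed.

Variable n' : nat.
Notation n := n'.+1.

(* The place (i, j, c) lives in the bags i + j and i + j + 1; the places where [kappa]
   jumps along the diagonal or [rho] wraps around are put into all bags. *)
Definition always (k : place n') : bool := let: (i, j, c) := k in (i == j) || (j == ord0).

Definition in_bag (k : place n') (t : nat) : bool :=
  let: (i, j, c) := k in always k || (i + j <= t <= (i + j).+1).

Definition gbag (t : path_graph (2 * n)) : {set gadget n'} := [set v : gvert n' | in_bag v.1 t].

Definition share_bag (k k' : place n') := exists t : 'I_(2 * n), in_bag k t && in_bag k' t.

Lemma share_bag_sym k k' : share_bag k k' -> share_bag k' k.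
Proof. by case=> t; rewrite andbC; exists t. Qed.

Lemma in_bag_self (k : place n') : exists2 t : 'I_(2 * n), val t = k.1.1 + k.1.2 & in_bag k t.
Proof.
case: k => [[i j] c]; have H : i + j < 2 * n by have := ltn_ord i; have := ltn_ord j; lia.
by exists (Ordinal H) => //=; rewrite leqnn leqnSn orbT.
Qed.

Lemma share_bag_refl k : share_bag k k.
Proof. by have [t _ kt] := in_bag_self k; exists t; rewrite kt. Qed.

Lemma share_bag_kappa k : share_bag k (kappa k).
Proof.
have [t Et kt] := in_bag_self k; exists t; rewrite kt /=.
case: k Et kt => [[i j] c] /= Et kt; case: ifP => _ /=; first by rewrite eqxx.
by rewrite Et addnC leqnn leqnSn orbT.
Qed.

Lemma share_bag_rho k : share_bag k (rho k).
Proof.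
case: k => [[i j] [|]] /=; last by have [t _ kt] := in_bag_self (i, j, false); exists t; rewrite kt.
have [jn|jn] := ltnP j.+1 n; last first.
  have [t _ kt] := in_bag_self (i, j, true); exists t; rewrite kt /=.
  have -> : ordS j = ord0.
    apply: val_inj; rewrite /=; have -> : j.+1 = n by have := ltn_ord j; lia.
    by rewrite modnn.
  by rewrite eqxx orbT.
have H : (i + j).+1 < 2 * n by have := ltn_ord i; lia.
exists (Ordinal H); rewrite /= modn_small // addnS !leqnn !leqnSn.
by rewrite !orbT.
Qed.

Lemma gadget_share_bag (u v : gadget n') : adj u v -> share_bag u.1 v.1.
Proof.
case: u => k [[[]|] []]; rewrite /= /cubic_adj => /or3P[]/eqP -> /=;
  try exact: share_bag_refl; try exact: share_bag_kappa; try exact: share_bag_rho.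
- by apply: share_bag_sym; rewrite -{2}[k]kappa'K; exact: share_bag_kappa.
- by apply: share_bag_sym; rewrite -{2}[k]rho'K; exact: share_bag_rho.
- by apply: share_bag_sym; rewrite -{2}[k]rho'K; exact: share_bag_rho.
Qed.

(** In bag t a row i admits only the columns i, 0, t - i and t - 1 - i; with two copies and six
    kinds of vertices this makes at most 48 n vertices. *)
Lemma gadget_treewidth : treewidth_at_most (gadget n') (48 * n).
Proof.
exists (path_graph (2 * n)), gbag; split.
  split.
  - exact: path_tree.
  - by move=> v; have [t _ kt] := in_bag_self v.1; exists t; rewrite inE.
  - by move=> u v /gadget_share_bag[t]; exists t; rewrite !inE.
  - move=> [[[i j] c] q] s t; rewrite !inE /= => vs vt.
    have := @path_connect (2 * n) (fun u => in_bag (i, j, c) u) s t.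
    rewrite /gbag => H; apply: connect_sub (H _); last first.
      have K (x a b z : nat) : x <= a <= x.+1 -> x <= b <= x.+1 ->
        minn a b <= z <= maxn a b -> x <= z <= x.+1 by lia.
      by move=> u /= Hu; case: ((i == j) || (j == ord0)) vs vt => //= vs vt; apply: K vs vt Hu.
    by move=> a b /= H'; apply: connect1; rewrite /= !inE.
move=> t.
pose F (p : 'I_n * bool * 'I_4 * kind) : gvert n' :=
  let: (i, c, q, kd) := p in
  ((i, if q == 0 :> nat then i else if q == 1 :> nat then ord0
       else if q == 2 :> nat then inord (t - i) else inord (t.-1 - i), c), kd).
have sub : gbag t \subset [set F p | p : 'I_n * bool * 'I_4 * kind].
  apply/subsetP => -[[[i j] c] kd]; rewrite inE /= => H; apply/imsetP.
  have [ij|ij] := eqVneq i j; first by exists (i, c, inord 0, kd) => //=; rewrite inordK //= ij.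
  have [j0|j0] := eqVneq j ord0; first by exists (i, c, inord 1, kd) => //=; rewrite inordK //= j0.
  move: H; rewrite (negPf ij) (negPf j0) /= => H.
  have [E|E] := eqVneq (i + j) t.
    exists (i, c, inord 2, kd) => //=; rewrite inordK //=; congr (_, _, _, _).
    by apply: val_inj; rewrite /= inordK -E addKn.
  exists (i, c, inord 3, kd) => //=; rewrite inordK //=; congr (_, _, _, _).
  have E' : t = (i + j).+1 :> nat by move/eqP: E; lia.
  by apply: val_inj; rewrite /= inordK E' /= addKn.
apply: leq_trans (subset_leq_card sub) _; apply: leq_trans (leq_imset_card _ _) _.
by rewrite !card_prod !card_ord card_option !card_bool; lia.
Qed.

End Treewidth.

(** * The slack matrix of the gadget graph *)

Section LowerBound.
Variable R : realType.
Local Open Scope ring_scope.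

Definition lrow (G : sgraph) (I : finType) (al : I -> R) (ep : I -> {set G}) : 'rV[R]_#|edges G| :=
  \row_k \sum_i al i * ((enum_val k : {set G}) == ep i)%:R.

Lemma lrowE (G : sgraph) (I : finType) (al : I -> R) (ep : I -> {set G}) X :
  (forall i, ep i \in edges G) ->
  (lrow al ep *m indicator R X) 0 0 = \sum_i al i * (ep i \in X)%:R.
Proof.
move=> epE; rewrite mxE; under eq_bigr do rewrite !mxE mulr_suml.
rewrite exchange_big /=; apply: eq_bigr => i _.
under eq_bigr do rewrite -mulrA; rewrite -mulr_sumr; congr (_ * _).
rewrite (bigD1 (enum_rank_in (epE i) (ep i))) //= enum_rankK_in // eqxx mul1r.
rewrite big1 ?addr0 // => k nk; case: eqP => [E|]; last by rewrite mul0r.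
by case/eqP: nk; rewrite -[LHS](enum_valK_in (epE i)) E.
Qed.

Lemma sum_indic (I : finType) (P : pred I) : \sum_i (P i)%:R = #|[set i | P i]|%:R :> R.
Proof. by rewrite -natr_sum -sum1dep_card [in RHS]big_mkcond. Qed.

Variable n' : nat.
Notation n := n'.+1.
Notation V := (gadget n').

Definition absent_edge (i : 'I_n) : {set V} := [set (((i, i, false), kIn) : gvert n'); gga ((i, i, false), kIn)].
Definition toggle_edge (p : 'I_n * 'I_n) : {set V} :=
  [set (((p.1, p.2, false), kW) : gvert n'); gla ((p.1, p.2, false), kW)].
Definition forced_edge (v : gvert n') : {set V} := [set v; gnu v].

Lemma absent_edge_in i : absent_edge i \in edges V. Proof. exact: cubic_ga. Qed.
Lemma toggle_edge_in p : toggle_edge p \in edges V. Proof. exact: cubic_la. Qed.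
Lemma forced_edge_in v : forced_edge v \in edges V. Proof. exact: cubic_nu. Qed.

Definition absent_in (a : seq bool) (X : {set {set V}}) := [set i : 'I_n | nth false a i && (absent_edge i \in X)].
Definition toggled_in (a : seq bool) (X : {set {set V}}) := [set p : 'I_n * 'I_n |
  [&& nth false a p.1, nth false a p.2, p.1 != p.2 & toggle_edge p \in X]].
Definition forced_used (X : {set {set V}}) := [set v : gvert n' | forced_edge v \in X].

(* With absent rows b, the slack is 1 - #(a and b), plus the number of toggles fired
   inside a, plus n times the number of missing forced edges. *)
Definition slack_row (a
 : seq bool) : 'rV[R]_#|edges V| :=
  lrow (fun p : 'I_n * 'I_n => [&& nth false a p.1, nth false a p.2 & p.1 != p.2]%:R) toggle_edge -
  lrow (fun i : 'I_n => (nth false a i)%:R) absent_edge - lrow (fun _ : gvert n' => n%:R) forced_edge.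

Definition slack_const : R := 1 + n%:R * #|V|%:R.

Lemma slackE a X : (slack_row a *m indicator R X) 0 0 + slack_const =
  1 - #|absent_in a X|%:R + #|toggled_in a X|%:R + n%:R * (#|V| - #|forced_used X|)%N%:R.
Proof.
have subE (A B : 'M[R]_1) : (A - B) 0 0 = A 0 0 - B 0 0 by rewrite !mxE.
rewrite /slack_row !mulmxBl !subE !lrowE; [|exact: forced_edge_in|exact: absent_edge_in|exact: toggle_edge_in].
rewrite -mulr_sumr !sum_indic natrB ?max_card //.
have -> : \sum_(i < n) (nth false a i)%:R * (absent_edge i \in X)%:R = #|absent_in a X|%:R :> R.
  by rewrite -sum_indic; apply: eq_bigr => i _; rewrite -natrM mulnb.
have -> : \sum_(p : 'I_n * 'I_n) [&& nth false a p.1, nth false a p.2 & p.1 != p.2]%:R * (toggle_edge p \in X)%:R =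
    #|toggled_in a X|%:R :> R.
  by rewrite -sum_indic; apply: eq_bigr => p _; rewrite -natrM mulnb -!andbA.
rewrite /slack_const /forced_used; ring.
Qed.

(** A single missing forced edge contributes n, enough to pay for all absent rows. If none is
    missing, fix one absent row [i0] in [a]: by [gadget_cut] every other absent row in [a] yields
    its own toggle, shared with [i0]. *)
Lemma slack_ge0 a X : @HamiltonianCycle V X -> 0 <= (slack_row a *m indicator R X) 0 0 + slack_const.
Proof.
move=> hX; rewrite slackE.
suff H : (#|absent_in a X| <= 1 + #|toggled_in a X| + n * (#|V| - #|forced_used X|))%N.
  by move: H; rewrite -(ler_nat R) !natrD natrM; lra.
have Sn : (#|absent_in a X| <= n)%N by rewrite -[X in (_ <= X)%N](card_ord n) max_card.
case: (boolP (forced_used X == setT)) => [/eqP NT|NT]; last first.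
  have : (#|forced_used X| < #|V|)%N.
    by rewrite ltn_neqAle max_card andbT; apply: contraNneq NT => E; rewrite eqEcard subsetT cardsT E /=.
  by move=> NV; have : (0 < #|V| - #|forced_used X|)%N; [lia|move: (_ - _)%N => d; nia].
have nuX v : [set v; gnu v] \in X by have := in_setT v; rewrite -NT inE.
rewrite NT cardsT subnn muln0 addn0.
case: (set_0Vmem (absent_in a X)) => [->|[i0 i0S]]; first by rewrite cards0.
suff : (#|absent_in a X :\ i0| <= #|toggled_in a X|)%N by rewrite (cardsD1 i0 (absent_in a X)) i0S leq_add2l.
pose F i := if toggle_edge (i0, i) \in X then (i0, i) else (i, i0).
rewrite -(card_in_imset (f := F)); last first.
  move=> i j; rewrite !inE /F => /andP[ii0 _] /andP[ji0 _].
  case: ifP => _; case: ifP => _ [] //.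
    by move=> E1 E2; rewrite -E1 eqxx in ji0.
  by move=> E1 E2; rewrite E1 eqxx in ii0.
apply: subset_leq_card; apply/subsetP => _ /imsetP[i + ->].
move: i0S; rewrite !inE => /andP[ai0 e0] /and3P[ii0 ai ei].
have cut := gadget_cut hX nuX; move: e0 ei; rewrite /absent_edge !(gadget_gaX hX nuX) => e0 ei.
have i0i : i0 != i by rewrite eq_sym.
have : (toggle_edge (i0, i) \in X) || (toggle_edge (i, i0) \in X) := cut i0 i i0i e0 ei.
by rewrite /F; case: ifP => [E _|_ /= E] /=; rewrite ai0 ai E ?i0i ?ii0.
Qed.

Lemma absent_edge_sol b i : (absent_edge i \in gsol n' b) = nth false b i.
Proof.
rewrite /absent_edge /gsol cubic_sol_ga /= ?negbK //;
  [exact: gnuK|exact: glaK|exact: ggaK|exact: gnu_ga|exact: gla_ga|exact: gstate_la|exact: gstate_ga].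
Qed.

Lemma toggle_edge_sol b p : p.1 != p.2 -> (toggle_edge p \in gsol n' b) = nth false b p.1 && nth false b p.2.
Proof.
move=> /negPf np; rewrite /toggle_edge /gsol cubic_sol_la /= ?np ?orbF //;
  [exact: gnuK|exact: glaK|exact: ggaK|exact: gnu_la|exact: gla_ga|exact: gstate_la|exact: gstate_ga].
Qed.

Lemma forced_edge_sol b v : forced_edge v \in gsol n' b.
Proof.
apply: cubic_sol_nu;
  [exact: gnuK|exact: glaK|exact: ggaK|exact: gstate_la|exact: gstate_ga].
Qed.

Lemma card_absent_in_gsol a b : #|absent_in a (gsol n' b)| = inter n a b.
Proof.
rewrite -sum1dep_card big_mkcond /inter; apply: eq_bigr => i _.
by rewrite absent_edge_sol; case: (_ && _).
Qed.

Lemma slack_gsol a b : (inter n a b <= 1)%N ->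
  (slack_row a *m indicator R (gsol n' b)) 0 0 + slack_const = 1 - (inter n a b)%:R.
Proof.
move=> i1; rewrite slackE card_absent_in_gsol.
have -> : toggled_in a (gsol n' b) = set0.
  have inS i : (i \in absent_in a (gsol n' b)) = nth false a i && nth false b i by rewrite in_set absent_edge_sol.
  apply/setP => -[i j]; rewrite in_set in_set0; apply/negP => /and4P[/= ai aj ij].
  rewrite toggle_edge_sol // => /andP[bi bj]; move: i1; rewrite -(card_absent_in_gsol a b).
  rewrite (cardsD1 i) (cardsD1 j) in_setD1 !inS ai bi aj bj eq_sym ij /=.
  by rewrite addnA.
have -> : forced_used (gsol n' b) = setT by apply/setP => v; rewrite in_set forced_edge_sol in_setT.
by rewrite cards0 cardsT subnn mulr0 !addr0.
Qed.

(** For empty [a] the slack is never 0, so [rectangle_cover] does not apply to it; these rows form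
    one additional rectangle, whence [m.+1]. *)
Lemma gadget_lower s :
  extension_complexity_at_most (@solution_polytope R HamiltonianCycle V) s ->
  exists2 m : nat, m%:R <= s & (3 ^ n <= m.+1 * 2 ^ n)%N.
Proof.
move=> /rectangle_cover[m ms H]; exists m => //.
pose Pa (a : seq bool) := (size a == n) && has id a.
pose Ta := {a : seq bool | Pa a}.
have [||| RA [RB HR]] := H Ta (seq bool) (fun a => slack_row (val a)) (fun _ => slack_const)
   (fun b => indicator R (gsol n' b)).
- by move=> a v [X hX <-]; apply: slack_ge0.
- move=> [a /= /andP[/eqP sa /hasP[x /(nthP false)[i ia Ei] xT]]].
  (* The singleton of an element [i] of [a] makes the slack 0. *)
  pose b := rcons (nseq i false) true.
  exists (indicator R (gsol n' b)); first by exists (gsol n' b) => //; exact: gsol_ham.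
  suff E : inter n a b = 1%N by rewrite slack_gsol E // subrr.
  rewrite sa in ia; rewrite /inter (bigD1 (Ordinal ia)) //= Ei nth_rcons size_nseq ltnn eqxx.
  rewrite (_ : x = true) // big1 //= => j; rewrite -val_eqE /= => ji.
  by rewrite nth_rcons size_nseq nth_nseq (negPf ji) !if_same andbF.
- by move=> b; exists (gsol n' b) => //; exact: gsol_ham.
pose RA' (i : 'I_m.+1) (a : seq bool) :=
  if unlift ord0 i is Some j then oapp (RA j) false (insub a : option Ta) else ~~ has id a.
pose RB' (i : 'I_m.+1) (b : seq bool) := if unlift ord0 i is Some j then RB j b else true.
have nohas a b : size a = n -> ~~ has id a -> inter n a b = 0%N.
  move=> sa na; rewrite /inter big1 // => i _.
  have /negPf -> // : ~~ nth false a i.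
  by apply: contra na => ai; apply/hasP; exists (nth false a i) => //; rewrite mem_nth ?sa.
apply: (@udisj_cover n m.+1 RA' RB').
  move=> i a b sa sb; rewrite /RA' /RB'; case: (unlift ord0 i) => [j|]; last first.
    by move=> na _; rewrite (nohas _ _ sa na).
  case: insubP => //= u _ ua RAj RBj; apply/eqP => i1.
  (* A pair meeting in one element has slack 0, so no rectangle may contain it. *)
  have : exists i, RA i u && RB i b by exists j; rewrite RAj.
  by move/HR; rewrite /= ua slack_gsol i1 // subrr ltxx.
move=> a b sa sb i0; case: (boolP (has id a)) => ha; last first.
  by exists ord0; rewrite /RA' /RB' unlift_none ha.
have pa : Pa a by rewrite /Pa sa eqxx.
have [j Hj] : exists i, RA i (exist _ a pa) && RB i b.
  by apply/HR; rewrite slack_gsol /= i0 // subr0.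
exists (lift ord0 j); rewrite /RA' /RB' liftK /=.
by rewrite insubT.
Qed.

End LowerBound.

(** * Choice of the parameters *)

Section Final.
Variable R : realType.
Local Open Scope classical_set_scope.
Local Open Scope ring_scope.

(** For q = 2^p and n = 4 q the number of vertices 12 n^2 = 192 q^2 is at most 2^(8 + 2 p); the
    exponent of the polynomial factor must stay below q. The summand N in p makes the parameter k
    exceed the threshold N. *)
Lemma poly_lt_exp c N p : p = (2 * (c + 4 + N))%N -> (1 + (8 + 2 * p) * c < 2 ^ p)%N.
Proof.
have H r : (16 * r.+1 <= 2 ^ (r + 4))%N by elim: r => // r IH; rewrite addSn expnS; lia.
move=> ->; have := H (c + N)%N.
have -> : (2 ^ (2 * (c + 4 + N)) = 2 ^ (c + N + 4) * 2 ^ (c + N + 4))%N.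
  by rewrite -expnD; congr expn; lia.
by move: (2 ^ _)%N => q Hq; have := leq_mul Hq Hq; nia.
Qed.

Lemma lower_bound (h : nat -> R) (c : nat) :
  h =o_\oo (fun k : nat => k%:R : R) ->
  has_no_extended_formulation HamiltonianCycle (fun k n => 2%:R `^ h k * n%:R ^+ c).
Proof.
move=> /eqoP/(_ (192%:R^-1)) ho.
(* With n = 4 q rows the treewidth bound is k = 48 n = 192 q, so this constant gives h(k) <= q. *)
have [N _ HN] := ho ltac:(by rewrite invr_gt0 ltr0n).
pose p := (2 * (c + 4 + N))%N; pose q := (2 ^ p)%N; pose n' := (4 * q).-1.
have q0 : (0 < q)%N by rewrite expn_gt0.
have nE : n'.+1 = (4 * q)%N by rewrite /n'; lia.
exists (48 * n'.+1)%N, (12 * n'.+1 ^ 2)%N, (gadget n'); split.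
- exact: card_gadget.
- exact: gadget_treewidth.
move=> /gadget_lower[m ms hm].
have pq : (p < q)%N by rewrite ltn_expl.
have hk : h (48 * n'.+1)%N <= q%:R.
  have : (N <= 48 * n'.+1)%N by rewrite nE; lia.
  move=> /HN /=; rewrite normr_nat nE => H; apply: le_trans (ler_norm _) (le_trans H _).
  by rewrite (_ : (48 * (4 * q) = 192 * q)%N) ?natrM ?mulKf ?pnatr_eq0 //; lia.
have mB : (m <= 2 ^ q * (12 * n'.+1 ^ 2) ^ c)%N.
  set B := (12 * _)%N in ms *.
  rewrite -(ler_nat R); apply: le_trans ms _; rewrite natrM !natrX ler_wpM2r ?exprn_ge0 //.
  by rewrite -powR_mulrn ?ler0n // ler_powR // ler1n.
have mB2 : (m.+1 <= 2 ^ (q + (1 + (8 + 2 * p) * c)))%N.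
  have : ((12 * n'.+1 ^ 2) ^ c <= 2 ^ ((8 + 2 * p) * c))%N.
    have [->|c0] := posnP c; first by rewrite muln0.
    rewrite expnM leq_exp2r // nE expnMn mulnA expnD leq_mul //.
    by rewrite /q -expnM mulnC.
  move=> H; have H2 : (m <= 2 ^ (q + (8 + 2 * p) * c))%N.
    by apply: leq_trans mB _; rewrite expnD leq_mul.
  rewrite (addnCA q) add1n expnS mul2n -addnn -addn1 leq_add // expn_gt0 //.
have lt1 : (1 + (8 + 2 * p) * c < q)%N by apply: poly_lt_exp.
(* As 4 times 2^4 is 64 < 81 = 3^4, the cover needs more than 2^(2 q) rectangles, against 2^q times
   a factor below 2^q from the assumed formulation. *)
have h4 : (4 ^ q * 2 ^ n'.+1 < 3 ^ n'.+1)%N.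
  rewrite nE !expnM -expnMn ltn_exp2r //.
have : (4 ^ q * 2 ^ n'.+1 < m.+1 * 2 ^ n'.+1)%N by apply: leq_trans h4 hm.
rewrite ltn_pmul2r ?expn_gt0 // => h5.
have := leq_trans h5 mB2; rewrite -[4%N]/(2 ^ 2)%N -expnM ltn_exp2l // mul2n -addnn ltn_add2l.
by rewrite ltnNge ltnW.
Qed.

End Final.

Local Open Scope classical_set_scope.
Local Open Scope ring_scope.

Theorem theorem6p6 (R : realType) :
  (exists (f : nat -> R) (c : nat),
     f =O_\oo (fun k : nat => k%:R * ln k%:R : R) /\
     has_extension_complexity HamiltonianCycle
       (fun k n => 2%:R `^ f k * n%:R ^+ c)) /\
  (ETH R ->
     forall (h : nat -> R) (c : nat),
       h =o_\oo (fun k : nat => k%:R : R) ->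
       has_no_extended_formulation HamiltonianCycle
         (fun k n => 2%:R `^ h k * n%:R ^+ c)).
Proof.
split; first exact: upper_bound.
by move=> _ h c; exact: lower_bound.
Qed.
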